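(* Let $M$ be a model of ZFA in which the set of atoms is $A=\{a_0,a_1,a_2,a_3,\dots\}$ (countably infinite, enumerated without repetition in $M$). In $M$, let $\Sigma$ be the group of all permutations of $A$ that preserve setwise each of the pairs $\{a_0,a_1\},\{a_2,a_3\},\dots$, and let $\mathcal{F}$ be the filter of subgroups of $\Sigma$ generated by the subgroups $\operatorname{Stab}(a_i)$, $i\in\mathbb{N}$. Then Frucht's Theorem fails in the permutation model $M'=M/\mathcal{F}$ (the second Frankel model).
   Context: ZFA is ZF modified to allow a set $A$ of atoms (objects with no elements, distinct from each other and from $\varnothing$; extensionality is restricted to non-atoms). A bijection $\pi$ of $A$ acts on the whole universe by its given action on atoms and, recursively, $\pi[S]=\{\pi[x]\mid x\in S\}$ for sets $S$. For $S\in M$, $\operatorname{Stab}(S)=\{\sigma\in\Sigma\mid \sigma[S]=S\}$. The filter generated by the subgroups $\operatorname{Stab}(a_i)$ consists of all subgroups of $\Sigma$ containing a finite intersection of such stabilizers; it is a normal filter. An $S\in M$ is symmetric if $\operatorname{Stab}(S)\in\mathcal{F}$, and hereditarily symmetric if $S$ and every element of its transitive closure are symmetric. The permutation model $M/\mathcal{F}$ is the class of hereditarily symmetric elements of $M$; it is a model of ZFA with the same set of atoms. A graph is a pair $\langle V(G),E(G)\rangle$ with $V(G)$ a set and $E(G)\subseteq V(G)^2$ symmetric and irreflexive; its automorphisms are the bijections of $V(G)$ preserving edges and non-edges. Frucht's Theorem is the statement that every group is isomorphic to the automorphism group of some graph. *)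

(* Defs.v *)
(* Plain Rocq: no library beyond the prelude is used. *)

Set Implicit Arguments.
Unset Strict Implicit.
Unset Printing Implicit Defensive.

(** * Structures for the language of ZFA *)

Record structure : Type := Structure {
  carrier :> Type;
  mem : carrier -> carrier -> Prop;
  atom : carrier -> Prop
}.

Arguments mem {s} x y.
Arguments atom {s} x.

Declare Scope zfa_scope.
Notation "x ∈ y" := (mem x y) (at level 70, no associativity) : zfa_scope.
Open Scope zfa_scope.

Definition is_set {U : structure} (x : U) : Prop := ~ atom x.

(** First-order formulas with de Bruijn indices; they occur only in the
    Separation and Replacement schemas.  An environment is an infinite sequence,
    but a formula reads finitely many entries of it, so that the entries beyond
    the bound variables serve as the parameters. *)

Inductive formula : Type :=
  | fMem (i j : nat)
  | fEq (i j : nat)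
  | fAtom (i : nat)
  | fFalse
  | fImp (p q : formula)
  | fAnd (p q : formula)
  | fOr (p q : formula)
  | fAll (p : formula)
  | fEx (p : formula).

Definition scons {X : Type} (x : X) (e : nat -> X) : nat -> X :=
  fun n => match n with O => x | S m => e m end.

Fixpoint sat {U : structure} (e : nat -> U) (p : formula) : Prop :=
  match p with
  | fMem i j => e i ∈ e j
  | fEq i j => e i = e j
  | fAtom i => atom (e i)
  | fFalse => False
  | fImp p q => sat e p -> sat e q
  | fAnd p q => sat e p /\ sat e q
  | fOr p q => sat e p \/ sat e q
  | fAll p => forall x : U, sat (scons x e) p
  | fEx p => exists x : U, sat (scons x e) p
  end.

(** * Set-theoretic vocabulary, interpreted in a structure *)

Section Vocabulary.
Context {U : structure}.
Implicit Types (x y z p s t u v w f : U).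

Definition subset x y : Prop := forall z, z ∈ x -> z ∈ y.

Definition is_empty x : Prop := is_set x /\ forall z, ~ z ∈ x.

Definition is_pair p x y : Prop :=
  is_set p /\ forall z, z ∈ p <-> z = x \/ z = y.

(* Kuratowski: p = {{x}, {x, y}} *)
Definition is_opair p x y : Prop :=
  exists u v, is_pair u x x /\ is_pair v x y /\ is_pair p u v.

(* s = x ∪ {x} *)
Definition is_succ s x : Prop :=
  is_set s /\ forall z, z ∈ s <-> z ∈ x \/ z = x.

Definition is_inductive w : Prop :=
  (exists z, is_empty z /\ z ∈ w) /\
  (forall x, x ∈ w -> exists s, is_succ s x /\ s ∈ w).

Definition is_omega w : Prop :=
  is_inductive w /\ forall v, is_inductive v -> subset w v.

Definition is_transitive t : Prop :=
  is_set t /\ forall x, x ∈ t -> subset x t.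

(* y belongs to the transitive closure of x *)
Definition in_tc x y : Prop :=
  forall t, is_transitive t -> subset x t -> y ∈ t.

Definition is_prod p x y : Prop :=
  is_set p /\
  forall q, q ∈ p <-> exists u v, u ∈ x /\ v ∈ y /\ is_opair q u v.

(* <x, y> ∈ f *)
Definition app f x y : Prop := exists p, is_opair p x y /\ p ∈ f.

(* every element of f is an ordered pair in x × y *)
Definition is_rel f x y : Prop :=
  is_set f /\
  forall p, p ∈ f -> exists u v, u ∈ x /\ v ∈ y /\ is_opair p u v.

Definition is_fun f x y : Prop :=
  is_rel f x y /\ forall u, u ∈ x -> exists! v, app f u v.

Definition is_bij f x y : Prop :=
  is_fun f x y /\
  (forall u u' v, app f u v -> app f u' v -> u = u') /\
  (forall v, v ∈ y -> exists u, app f u v).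

(* finiteness in the sense of U, whose natural numbers may be nonstandard *)
Definition is_finite x : Prop :=
  is_set x /\ exists w n f, is_omega w /\ n ∈ w /\ is_bij f n x.

(* u = s ∘ t, when s, t, u are functions that can be so composed *)
Definition is_comp u s t : Prop :=
  forall x y z, app t x y -> app s y z -> app u x z.

(* t = s^-1, when s and t are permutations of the same set *)
Definition is_inverse t s : Prop := forall x y, app s x y -> app t y x.

(* m is a binary operation on x, and <<a, b>, c> ∈ m *)
Definition is_binop m x : Prop := exists p, is_prod p x x /\ is_fun m p x.

Definition app2 m a b c : Prop := exists p : U, is_opair p a b /\ app m p c.

(** * Groups, graphs and Frucht's Theorem *)

Definition is_group (G m : U) : Prop :=
  is_set G /\ is_binop m G /\
  (forall x y z xy yz r : U, x ∈ G -> y ∈ G -> z ∈ G ->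
     app2 m x y xy -> app2 m y z yz -> app2 m xy z r -> app2 m x yz r) /\
  (exists e, e ∈ G /\
     (forall x, x ∈ G -> app2 m e x x /\ app2 m x e x) /\
     (forall x, x ∈ G -> exists y, y ∈ G /\ app2 m x y e /\ app2 m y x e)).

Definition is_group_iso (f G m H k : U) : Prop :=
  is_bij f G H /\
  forall x y z x' y' z' : U,
    app f x x' -> app f y y' -> app f z z' ->
    app2 m x y z -> app2 k x' y' z'.

Definition is_graph (V E : U) : Prop :=
  is_set V /\ is_rel E V V /\
  (forall x y, app E x y -> app E y x) /\
  (forall x, ~ app E x x).

Definition is_graph_aut (V E s : U) : Prop :=
  is_bij s V V /\
  forall x y x' y' : U, app s x x' -> app s y y' ->
    (app E x y <-> app E x' y').

(* P is the set of automorphisms of <V, E>, and c is composition on P *)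
Definition is_aut_group (V E P c : U) : Prop :=
  is_set P /\
  (forall s, s ∈ P <-> is_graph_aut V E s) /\
  is_binop c P /\
  (forall s t u, app2 c s t u -> is_comp u s t).

(** * Permutations of the atoms *)

Definition is_atom_set (A : U) : Prop :=
  is_set A /\ forall x, x ∈ A <-> atom x.

(* [act s x y] says that s[x] = y, for a permutation s of the set of atoms.
   The recursion s[x] = {s[z] | z ∈ x} is witnessed by a function f on a
   transitive set t containing x. *)
Definition act s x y : Prop :=
  exists t r f,
    is_transitive t /\ x ∈ t /\ is_fun f t r /\
    (forall z v, app f z v ->
       (atom z -> app s z v) /\
       (is_set z ->
          is_set v /\ forall u, u ∈ v <-> exists z', z' ∈ z /\ app f z' u)) /\
    app f x y.

(* H is a subgroup of the permutation group Sigma *)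
Definition is_subgroup (H Sigma : U) : Prop :=
  is_set H /\ subset H Sigma /\
  (exists i, i ∈ H /\ forall x y, app i x y -> x = y) /\
  (forall s t, s ∈ H -> t ∈ H -> exists u, u ∈ H /\ is_comp u s t) /\
  (forall s, s ∈ H -> exists t, t ∈ H /\ is_inverse t s).

(* K = Stab(x) *)
Definition is_stab (Sigma x K : U) : Prop :=
  is_set K /\ forall s, s ∈ K <-> s ∈ Sigma /\ act s x x.

(* F is the filter of subgroups of Sigma generated by the subgroups in B; the
   intersection of an empty family is Sigma. *)
Definition is_generated_filter (Sigma : U) (B : U -> Prop) (F : U) : Prop :=
  is_set F /\
  forall H, H ∈ F <->
    is_subgroup H Sigma /\
    exists C, is_finite C /\ (forall K, K ∈ C -> B K) /\
      forall s, s ∈ Sigma -> (forall K, K ∈ C -> s ∈ K) -> s ∈ H.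

Definition is_symmetric (Sigma F x : U) : Prop :=
  exists K, is_stab Sigma x K /\ K ∈ F.

Definition is_hereditarily_symmetric (Sigma F x : U) : Prop :=
  is_symmetric Sigma F x /\ forall y, in_tc x y -> is_symmetric Sigma F y.

(** * The pairs {a_0, a_1}, {a_2, a_3}, ... *)

(* d : w -> w is the function n |-> 2 n *)
Definition is_doubling (w d : U) : Prop :=
  is_fun d w w /\
  (forall z, is_empty z -> app d z z) /\
  (forall n n' k k' k'' : U, n ∈ w -> is_succ n' n -> app d n k ->
     is_succ k' k -> is_succ k'' k' -> app d n' k'').

(* p = {a_(2n), a_(2n+1)} for some n ∈ w *)
Definition is_atom_pair (w a p : U) : Prop :=
  exists d n k k' x y : U,
    is_doubling w d /\ app d n k /\ is_succ k' k /\
    app a k x /\ app a k' y /\ is_pair p x y.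

(* Sigma is the group of the permutations of A that preserve each pair *)
Definition is_pair_group (w A a Sigma : U) : Prop :=
  is_set Sigma /\
  forall s, s ∈ Sigma <->
    is_bij s A A /\ forall p, is_atom_pair w a p -> act s p p.

(* F is the filter generated by the subgroups Stab(a_i) *)
Definition is_atom_stab_filter (a Sigma F : U) : Prop :=
  is_generated_filter Sigma
    (fun K => exists i x, app a i x /\ is_stab Sigma x K) F.

End Vocabulary.

(* "Frucht's Theorem holds in U" *)
Definition Frucht (U : structure) : Prop :=
  forall G m : U, is_group G m ->
    exists V E P c f : U,
      is_graph V E /\ is_aut_group V E P c /\ is_group_iso f G m P c.

(** * Models of ZFA *)

Record ZFA (U : structure) : Prop := {
  zfa_atoms : forall x y : U, atom x -> ~ y ∈ x;
  zfa_atom_set : exists A : U, is_atom_set A;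
  zfa_extensionality : forall x y : U, is_set x -> is_set y ->
    (forall z, z ∈ x <-> z ∈ y) -> x = y;
  zfa_foundation : forall x : U, (exists y, y ∈ x) ->
    exists y, y ∈ x /\ forall z, z ∈ x -> ~ z ∈ y;
  zfa_pairing : forall x y : U, exists p, is_pair p x y;
  zfa_union : forall x : U, exists y, is_set y /\
    forall z, z ∈ y <-> exists u, u ∈ x /\ z ∈ u;
  zfa_power : forall x : U, is_set x -> exists y, is_set y /\
    forall z, z ∈ y <-> is_set z /\ subset z x;
  zfa_infinity : exists w : U, is_inductive w;
  zfa_separation : forall (phi : formula) (e : nat -> U) (x : U),
    exists y, is_set y /\
      forall z, z ∈ y <-> z ∈ x /\ sat (scons z e) phi;
  zfa_replacement : forall (phi : formula) (e : nat -> U) (x : U),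
    (forall u v v', u ∈ x ->
       sat (scons u (scons v e)) phi -> sat (scons u (scons v' e)) phi ->
       v = v') ->
    exists y, is_set y /\
      forall v, v ∈ y <-> exists u, u ∈ x /\ sat (scons u (scons v e)) phi
}.

(** * Permutation models *)

(* The class M/F of hereditarily symmetric elements of M *)
Definition perm_model (M : structure) (Sigma F : M) : structure :=
  {| carrier := {x : M | is_hereditarily_symmetric Sigma F x};
     mem := fun x y => proj1_sig x ∈ proj1_sig y;
     atom := fun x => atom (proj1_sig x) |}.

(* Main.v *)
Require Import Defs.
From Stdlib Require Import Classical ClassicalEpsilon Arith.

Set Implicit Arguments.
Unset Strict Implicit.

(** The counterexample is an abelian group on which the permutations of the atoms
    act nontrivially, however large the finite set of atoms that they fix: the
    set [G] of all symmetric sets of atoms, under symmetric difference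
    ([sym_atoms_group]).

    Suppose that [f] is, in the permutation model, an isomorphism from [G] to the
    automorphism group of a graph [(V, E)].  Finitely many atoms support [V], [E]
    and [f], so the transposition [s] of the two members of some pair fixes all
    three ([transposition_in_fixer]).  Since [s] fixes [V] and [E], its
    restriction to [V] is an automorphism of the graph, and since the group Sigma
    is commutative, every permutation fixing [V] fixes this restriction, which
    therefore belongs to the permutation model ([hsym_restriction]).  Like [G],
    the automorphism group is abelian, so that every automorphism commutes with
    the restriction of [s]; that is to say that [s] fixes every automorphism as
    an object ([image_fixed_of_commute]).  As [s] fixes [f] too, it fixes every
    element of [G].  But [s] moves the singleton of an atom that it transposes.

    The rest of the file is the set theory that gives this argument a meaning in
    an arbitrary, possibly ill-founded, model of ZFA.  The schemas are used
    through a semantic notion of definability.  Recursion on the natural numbers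
    yields transitive closures, hence induction on membership for definable
    classes, hence the action [image s] of a permutation [s] on the whole
    universe, as well as the doubling function that numbers the pairs.  That
    Sigma is commutative depends on the latter: every atom has to lie in some
    pair.  Finite subsets of the filter base are handled by internal induction
    ([finite_ind]), and the permutation model only by absoluteness: it is
    transitive and closed under ordered pairs. *)

(** * Semantic definability *)

Section Definability.
Context {U : structure}.
Implicit Types (P Q : (nat -> U) -> Prop) (s t : (nat -> U) -> U).

Definition up (r : nat -> nat) (n : nat) : nat :=
  match n with O => O | S m => S (r m) end.

Fixpoint rename (r : nat -> nat) (p : formula) : formula :=
  match p with
  | fMem i j => fMem (r i) (r j)
  | fEq i j => fEq (r i) (r j)
  | fAtom i => fAtom (r i)
  | fFalse => fFalse
  | fImp p q => fImp (rename r p) (rename r q)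
  | fAnd p q => fAnd (rename r p) (rename r q)
  | fOr p q => fOr (rename r p) (rename r q)
  | fAll p => fAll (rename (up r) p)
  | fEx p => fEx (rename (up r) p)
  end.

Lemma sat_ext p : forall e e' : nat -> U,
  (forall n, e n = e' n) -> (sat e p <-> sat e' p).
Proof.
  assert (hs : forall (e e' : nat -> U), (forall n, e n = e' n) ->
             forall x n, scons x e n = scons x e' n)
    by (intros e e' he x [|n]; simpl; auto).
  induction p; simpl; intros e e' he.
  - now rewrite !he.
  - now rewrite !he.
  - now rewrite !he.
  - tauto.
  - now rewrite (IHp1 _ _ he), (IHp2 _ _ he).
  - now rewrite (IHp1 _ _ he), (IHp2 _ _ he).
  - now rewrite (IHp1 _ _ he), (IHp2 _ _ he).
  - split; intros h x; generalize (h x); apply IHp; intros n;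
      [symmetry|]; now apply hs.
  - split; intros [x h]; exists x; revert h; apply IHp; intros n;
      [symmetry|]; now apply hs.
Qed.

Lemma sat_rename p : forall (r : nat -> nat) (e : nat -> U),
  sat e (rename r p) <-> sat (fun n => e (r n)) p.
Proof.
  assert (hs : forall r (e : nat -> U) x p,
             sat (fun n => scons x e (up r n)) p
             <-> sat (scons x (fun n => e (r n))) p)
    by (intros r e x q; apply sat_ext; intros [|n]; reflexivity).
  induction p; simpl; intros r e; try tauto.
  - now rewrite IHp1, IHp2.
  - now rewrite IHp1, IHp2.
  - now rewrite IHp1, IHp2.
  - split; intros h x; generalize (h x); rewrite IHp, hs; auto.
  - split; intros [x h]; exists x; revert h; rewrite IHp, hs; auto.
Qed.

(** Each free variable of a formula is bound by [v] either to an entry of the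
    environment or to a fixed parameter of the structure. *)
Definition read (v : nat -> nat + U) (e : nat -> U) (n : nat) : U :=
  match v n with inl i => e i | inr c => c end.

(** Predicates of an environment that a first-order formula with parameters
    expresses.  The closure lemmas below let the [definability] tactic establish
    the hypotheses of the schemas without a formula ever being written. *)
Definition definable P : Prop :=
  exists phi v, forall e, P e <-> sat (read v e) phi.

(** The slots of the two formulas are made disjoint by renaming them to the even
    and to the odd numbers. *)
Lemma definable2 P Q : definable P -> definable Q ->
  exists phi psi v, forall e,
    (P e <-> sat (read v e) phi) /\ (Q e <-> sat (read v e) psi).
Proof.
  intros (phi & v & hP) (psi & v' & hQ).
  exists (rename (fun n => 2 * n) phi), (rename (fun n => S (2 * n)) psi),
    (fun n => if Nat.even n then v (Nat.div2 n) else v' (Nat.div2 n)).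
  intros e; rewrite hP, hQ, !sat_rename; split; apply sat_ext; intros n;
    unfold read.
  - now rewrite Nat.even_even, Nat.div2_double.
  - replace (Nat.even (S (2 * n))) with false
      by now rewrite <- Nat.add_1_r, Nat.even_odd.
    now rewrite Nat.div2_succ_double.
Qed.

Lemma def_and P Q : definable P -> definable Q ->
  definable (fun e => P e /\ Q e).
Proof.
  intros hP hQ; destruct (definable2 hP hQ) as (phi & psi & v & h).
  exists (fAnd phi psi), v; intros e; simpl; destruct (h e); tauto.
Qed.

Lemma def_or P Q : definable P -> definable Q ->
  definable (fun e => P e \/ Q e).
Proof.
  intros hP hQ; destruct (definable2 hP hQ) as (phi & psi & v & h).
  exists (fOr phi psi), v; intros e; simpl; destruct (h e); tauto.
Qed.

Lemma def_imp P Q : definable P -> definable Q ->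
  definable (fun e => P e -> Q e).
Proof.
  intros hP hQ; destruct (definable2 hP hQ) as (phi & psi & v & h).
  exists (fImp phi psi), v; intros e; simpl; destruct (h e); tauto.
Qed.

Lemma def_const (C : Prop) : definable (fun _ => C).
Proof.
  destruct (classic C) as [h | h].
  - exists (fImp fFalse fFalse), (fun n => inl n); simpl; tauto.
  - exists fFalse, (fun n => inl n); simpl; tauto.
Qed.

Lemma def_not P : definable P -> definable (fun e => ~ P e).
Proof. intros h; apply def_imp; [exact h | apply def_const]. Qed.

Lemma def_iff P Q : definable P -> definable Q ->
  definable (fun e => P e <-> Q e).
Proof. intros; apply def_and; apply def_imp; assumption. Qed.

(** At a quantifier a binding [v] is split: the slots bound to entry 0 become the
    quantified variable, and any other slot [n] is moved to [S n], where
    [free_var v] binds it in the shorter environment. *)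
Definition bound_var (v : nat -> nat + U) (n : nat) : nat :=
  match v n with inl O => O | _ => S n end.

Definition free_var (v : nat -> nat + U) (n : nat) : nat + U :=
  match v n with inl i => inl (pred i) | inr c => inr c end.

Lemma sat_bound v phi (x : U) e :
  sat (scons x (read (free_var v) e)) (rename (bound_var v) phi)
  <-> sat (read v (scons x e)) phi.
Proof.
  rewrite sat_rename; apply sat_ext; intros n.
  unfold bound_var, read; destruct (v n) as [[|i]|c] eqn:hv; simpl;
    unfold free_var; rewrite ?hv; reflexivity.
Qed.

Lemma def_ex (Q : U -> (nat -> U) -> Prop) :
  definable (fun e => Q (e 0) (fun n => e (S n))) ->
  definable (fun e => exists x, Q x e).
Proof.
  intros (phi & v & h).
  exists (fEx (rename (bound_var v) phi)), (free_var v); intros e; simpl.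
  split; intros [x hx]; exists x; revert hx;
    rewrite sat_bound, <- h; simpl; auto.
Qed.

Lemma def_all (Q : U -> (nat -> U) -> Prop) :
  definable (fun e => Q (e 0) (fun n => e (S n))) ->
  definable (fun e => forall x, Q x e).
Proof.
  intros (phi & v & h).
  exists (fAll (rename (bound_var v) phi)), (free_var v); intros e; simpl.
  split; intros hx x; generalize (hx x); rewrite sat_bound, <- h; simpl; auto.
Qed.

Lemma def_reindex (r : nat -> nat) P :
  definable P -> definable (fun e => P (fun n => e (r n))).
Proof.
  intros (phi & v & h).
  exists phi, (fun n => match v n with inl i => inl (r i) | inr c => inr c end).
  intros e; rewrite h; apply sat_ext; intros n; unfold read.
  now destruct (v n).
Qed.

(** Class functions, rather than variables alone, may thus occur in definable
    predicates; in the defining formula, entry 0 stands for the value. *)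
Definition term t : Prop := definable (fun e => e 0 = t (fun n => e (S n))).

Lemma term_var i : term (fun e => e i).
Proof. exists (fEq 0 (S i)), (fun n => inl n); intros e; reflexivity. Qed.

Lemma term_const c : term (fun _ => c).
Proof.
  exists (fEq 0 1), (fun n => match n with O => inl O | _ => inr c end).
  intros e; reflexivity.
Qed.

Lemma def_subst (Q : U -> (nat -> U) -> Prop) t : term t ->
  definable (fun e => Q (e 0) (fun n => e (S n))) ->
  definable (fun e => Q (t e) e).
Proof.
  intros ht hQ.
  assert (h : definable (fun e => exists x, x = t e /\ Q x e))
    by (apply def_ex, def_and; assumption).
  destruct h as (phi & v & h); exists phi, v; intros e; rewrite <- h.
  split; [intros hq; exists (t e); auto | intros (x & -> & hq); exact hq].
Qed.

Lemma term_shift t : term t -> term (fun e => t (fun n => e (S n))).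
Proof.
  intros h; exact (def_reindex (fun n => match n with 0 => 0 | S m => S (S m) end) h).
Qed.

Lemma def_rel1 (R : U -> Prop) t :
  definable (fun e => R (e 0)) -> term t -> definable (fun e => R (t e)).
Proof. intros hR ht; exact (@def_subst (fun x _ => R x) t ht hR). Qed.

Lemma def_rel2 (R : U -> U -> Prop) s t :
  definable (fun e => R (e 0) (e 1)) -> term s -> term t ->
  definable (fun e => R (s e) (t e)).
Proof.
  intros hR hs ht; apply (@def_subst (fun x e => R x (t e)) s hs).
  apply (@def_subst (fun y e => R (e 0) y) _ (term_shift ht)).
  exact (def_reindex (fun n => match n with 0 => 1 | _ => 0 end) hR).
Qed.

Lemma def_mem s t : term s -> term t -> definable (fun e => s e ∈ t e).
Proof.
  apply def_rel2; exists (fMem 0 1), (fun n => inl n); intros e; reflexivity.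
Qed.

Lemma def_eq s t : term s -> term t -> definable (fun e => s e = t e).
Proof.
  apply def_rel2; exists (fEq 0 1), (fun n => inl n); intros e; reflexivity.
Qed.

Lemma def_atom t : term t -> definable (fun e => atom (t e)).
Proof.
  apply def_rel1; exists (fAtom 0), (fun n => inl n); intros e; reflexivity.
Qed.

Lemma term_graph1 (R : U -> U -> Prop) (g : U -> U) t :
  definable (fun e => R (e 0) (e 1)) -> (forall x y, R x y <-> x = g y) ->
  term t -> term (fun e => g (t e)).
Proof.
  intros hR hg ht; unfold term.
  destruct (def_rel2 hR (term_var 0) (term_shift ht)) as (phi & v & h).
  exists phi, v; intros e; rewrite <- h, hg; reflexivity.
Qed.

Lemma term_graph2 (R : U -> U -> U -> Prop) (g : U -> U -> U) s t :
  definable (fun e => R (e 0) (e 1) (e 2)) ->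
  (forall x y z, R x y z <-> x = g y z) ->
  term s -> term t -> term (fun e => g (s e) (t e)).
Proof.
  intros hR hg hs ht; unfold term.
  apply (@def_subst (fun y e => e 0 = g y (t (fun n => e (S n)))) _ (term_shift hs)).
  apply (@def_subst (fun z e => e 1 = g (e 0) z) _ (term_shift (term_shift ht))).
  destruct (def_reindex (fun n => match n with 0 => 2 | 1 => 1 | _ => 0 end) hR)
    as (phi & v & h).
  exists phi, v; intros e; rewrite <- h, hg; reflexivity.
Qed.

Lemma definable_formula1 (P : U -> Prop) (c : U) :
  definable (fun e => P (e 0)) ->
  exists phi e, forall x, P x <-> sat (scons x e) phi.
Proof.
  intros (phi & v & h).
  exists (rename (bound_var v) phi), (read (free_var v) (fun _ => c)).
  intros x; rewrite sat_bound, <- h; reflexivity.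
Qed.

Lemma definable_formula2 (P : U -> U -> Prop) (c : U) :
  definable (fun e => P (e 0) (e 1)) ->
  exists phi e, forall x y, P x y <-> sat (scons x (scons y e)) phi.
Proof.
  intros (phi & v & h).
  set (r n := match v n with inl 0 => 0 | inl 1 => 1 | _ => S (S n) end).
  exists (rename r phi),
    (fun n => match v n with inl _ => c | inr d => d end).
  intros x y; rewrite sat_rename.
  rewrite (h (scons x (scons y (fun _ => c)))); apply sat_ext; intros n.
  unfold read, r; destruct (v n) as [[|[|i]]|d] eqn:hv; simpl;
    rewrite ?hv; reflexivity.
Qed.

End Definability.

Create HintDb terms.

(** The set-theoretic vocabulary needs no closure lemmas of its own, because
    [apply] unfolds it until a connective appears.  The atomic cases come first so
    that they are not mistaken for constants. *)
Ltac definability_step :=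
  cbv beta;
  lazymatch goal with
  | |- term _ =>
    first [apply term_var | apply term_const | solve [eauto with terms nocore]]
  | |- definable _ =>
    first
      [ apply def_mem | apply def_eq | apply def_atom
      | apply def_iff | apply def_and | apply def_or | apply def_not
      | apply def_imp | apply def_ex | apply def_all | apply def_const ]
  end.
Ltac definability := repeat definability_step.

(** * Set theory inside a model of ZFA *)

(** Unique existence in the axioms yields functions on the universe; as a class,
    the axioms need not be passed to them explicitly. *)
Existing Class ZFA.

Section SetTheory.
Context {M : structure} {hM : ZFA M}.
Implicit Types (x y z u v f p : M).

Lemma set_ext x y :
  is_set x -> is_set y -> (forall z, z ∈ x <-> z ∈ y) -> x = y.
Proof. apply (zfa_extensionality hM). Qed.

Lemma inhabited_is_set x y : y ∈ x -> is_set x.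
Proof. intros h ha; exact (zfa_atoms hM ha h). Qed.

Lemma separation (P : M -> Prop) x : definable (fun e => P (e 0)) ->
  exists y, is_set y /\ forall z, z ∈ y <-> z ∈ x /\ P z.
Proof.
  intros hP; destruct (definable_formula1 x hP) as (phi & e & h).
  destruct (zfa_separation hM phi e x) as (y & hy & hz).
  exists y; split; [exact hy | intros z; now rewrite hz, h].
Qed.

Lemma replacement (R : M -> M -> Prop) x :
  definable (fun e => R (e 0) (e 1)) ->
  (forall u v v', u ∈ x -> R u v -> R u v' -> v = v') ->
  exists y, is_set y /\ forall v, v ∈ y <-> exists u, u ∈ x /\ R u v.
Proof.
  intros hR hf; destruct (definable_formula2 x hR) as (phi & e & h).
  destruct (zfa_replacement hM (phi := phi) (e := e) (x := x)) as (y & hy & hz).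
  - intros u v v' hu; rewrite <- !h; eauto.
  - exists y; split; [exact hy | intros v; rewrite hz].
    split; intros (u & hu & hr); exists u; (split; [exact hu|]); now apply h.
Qed.

Definition witness (P : M -> Prop) (h : exists x, P x) : M :=
  proj1_sig (constructive_indefinite_description P h).

Lemma witnessP (P : M -> Prop) (h : exists x, P x) : P (witness h).
Proof. unfold witness; now destruct constructive_indefinite_description. Qed.

Definition pair x y : M := witness (zfa_pairing hM x y).

Lemma pair_set x y : is_set (pair x y).
Proof. apply (witnessP (zfa_pairing hM x y)). Qed.

Lemma in_pair x y z : z ∈ pair x y <-> z = x \/ z = y.
Proof. apply (witnessP (zfa_pairing hM x y)). Qed.

Lemma is_pairE p x y : is_pair p x y <-> p = pair x y.
Proof.
  split.
  - intros [hp h]; apply set_ext; [exact hp | apply pair_set |].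
    intros z; rewrite h, in_pair; tauto.
  - intros ->; split; [apply pair_set | intros z; apply in_pair].
Qed.

Lemma pairC x y : pair x y = pair y x.
Proof.
  apply set_ext; try apply pair_set; intros z; rewrite !in_pair; tauto.
Qed.

Definition opair x y : M := pair (pair x x) (pair x y).

Lemma is_opairE p x y : is_opair p x y <-> p = opair x y.
Proof.
  split.
  - intros (u & v & hu & hv & hp).
    apply is_pairE in hu, hv, hp; now subst.
  - intros ->; exists (pair x x), (pair x y); rewrite !is_pairE; auto.
Qed.

Lemma pair_diag x y z : pair x y = pair z z -> x = z /\ y = z.
Proof.
  intros h; split; [assert (hx : x ∈ pair z z) by (rewrite <- h, in_pair; auto)
                   |assert (hx : y ∈ pair z z) by (rewrite <- h, in_pair; auto)];
    apply in_pair in hx; tauto.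
Qed.

Lemma pair_cancel x y y' : pair x y = pair x y' -> y = y'.
Proof.
  intros h.
  assert (h1 : y ∈ pair x y') by (rewrite <- h, in_pair; auto).
  assert (h2 : y' ∈ pair x y) by (rewrite h, in_pair; auto).
  rewrite in_pair in h1, h2; destruct h1 as [->| ->]; auto.
  destruct h2 as [->| ->]; auto.
Qed.

Lemma opair_inj x y x' y' : opair x y = opair x' y' -> x = x' /\ y = y'.
Proof.
  intros h.
  assert (hx : x = x').
  { assert (h1 : pair x x ∈ opair x' y') by (rewrite <- h; apply in_pair; auto).
    apply in_pair in h1; destruct h1 as [h1|h1].
    - now apply pair_diag in h1.
    - symmetry in h1; apply pair_diag in h1; now symmetry. }
  subst x'; split; [reflexivity|].
  exact (pair_cancel (pair_cancel h)).
Qed.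

Lemma appE f x y : app f x y <-> opair x y ∈ f.
Proof.
  split.
  - intros (p & hp & h); apply is_opairE in hp; now subst.
  - intros h; exists (opair x y); split; [now apply is_opairE | exact h].
Qed.

Lemma void_exists : exists z : M, is_empty z.
Proof.
  destruct (zfa_infinity hM) as (w & (z & hz & _) & _); now exists z.
Qed.

Definition void : M := witness void_exists.

Lemma void_set : is_set void.
Proof. apply (witnessP void_exists). Qed.

Lemma in_void z : ~ z ∈ void.
Proof. apply (witnessP void_exists). Qed.

Lemma is_emptyE z : is_empty z <-> z = void.
Proof.
  split.
  - intros [hz h]; apply set_ext; [exact hz | apply void_set|].
    intros u; split; intros hu; [now apply h in hu | now apply in_void in hu].
  - intros ->; split; [apply void_set | apply in_void].
Qed.

Definition bigcup x : M := witness (zfa_union hM x).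

Lemma bigcup_set x : is_set (bigcup x).
Proof. apply (witnessP (zfa_union hM x)). Qed.

Lemma in_bigcup x z : z ∈ bigcup x <-> exists u, u ∈ x /\ z ∈ u.
Proof. apply (witnessP (zfa_union hM x)). Qed.

Definition cup x y : M := bigcup (pair x y).

Lemma cup_set x y : is_set (cup x y).
Proof. apply bigcup_set. Qed.

Lemma in_cup x y z : z ∈ cup x y <-> z ∈ x \/ z ∈ y.
Proof.
  unfold cup; rewrite in_bigcup; split.
  - intros (u & hu & hz); apply in_pair in hu; destruct hu as [->| ->]; auto.
  - intros [h|h]; [exists x | exists y]; rewrite in_pair; auto.
Qed.

Definition adjoin x y : M := cup x (pair y y).

Lemma adjoin_set x y : is_set (adjoin x y).
Proof. apply cup_set. Qed.

Lemma in_adjoin x y z : z ∈ adjoin x y <-> z ∈ x \/ z = y.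
Proof. unfold adjoin; rewrite in_cup, in_pair; tauto. Qed.

Definition succ x : M := adjoin x x.

Lemma succ_set x : is_set (succ x).
Proof. apply adjoin_set. Qed.

Lemma in_succ x z : z ∈ succ x <-> z ∈ x \/ z = x.
Proof. apply in_adjoin. Qed.

Lemma is_succE s x : is_succ s x <-> s = succ x.
Proof.
  split.
  - intros [hs h]; apply set_ext; [exact hs | apply succ_set|].
    intros z; now rewrite h, in_succ.
  - intros ->; split; [apply succ_set | apply in_succ].
Qed.

Lemma term_pair s t : term s -> term t -> term (fun e => pair (s e) (t e)).
Proof.
  apply (@term_graph2 M (fun p x y => is_pair p x y) pair);
    [definability | apply is_pairE].
Qed.

Lemma term_opair s t : term s -> term t -> term (fun e => opair (s e) (t e)).
Proof. intros; unfold opair; repeat apply term_pair; assumption. Qed.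

Lemma term_bigcup t : term t -> term (fun e => bigcup (t e)).
Proof.
  apply (@term_graph1 M
    (fun y x => is_set y /\ forall z, z ∈ y <-> exists u, u ∈ x /\ z ∈ u) bigcup).
  - definability.
  - intros x y; split.
    + intros [hx h]; apply set_ext; [exact hx | apply bigcup_set|].
      intros z; now rewrite h, in_bigcup.
    + intros ->; split; [apply bigcup_set | apply in_bigcup].
Qed.

Lemma term_adjoin s t : term s -> term t -> term (fun e => adjoin (s e) (t e)).
Proof.
  intros; unfold adjoin, cup; apply term_bigcup; repeat apply term_pair; assumption.
Qed.

Lemma term_succ t : term t -> term (fun e => succ (t e)).
Proof. intros; apply term_adjoin; assumption. Qed.

(** For an atom, the set of its subsets is the singleton of the empty set. *)
Lemma power_exists x : exists y,
  is_set y /\ forall z, z ∈ y <-> is_set z /\ subset z x.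
Proof.
  destruct (classic (is_set x)) as [h|h]; [exact (zfa_power hM h)|].
  exists (pair void void); split; [apply pair_set|]; intros z; rewrite in_pair.
  split.
  - intros hz; assert (z = void) as -> by tauto; split; [apply void_set|].
    intros u hu; now apply in_void in hu.
  - intros [hz hs]; left; apply is_emptyE; split; [exact hz|].
    intros u hu; exact (h (inhabited_is_set (hs u hu))).
Qed.

(** * Functions *)

Lemma fun_dom f x y u v : is_fun f x y -> app f u v -> u ∈ x /\ v ∈ y.
Proof.
  intros [[_ hf] _] (p & hp & h).
  destruct (hf p h) as (u' & v' & hu & hv & hp').
  apply is_opairE in hp, hp'; subst p.
  now apply opair_inj in hp'; destruct hp'; subst.
Qed.

Lemma fun_total f x y u : is_fun f x y -> u ∈ x -> exists v, app f u v.
Proof. intros [_ hf] hu; destruct (hf u hu) as (v & hv & _); now exists v. Qed.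

Lemma fun_uniq f x y u v v' : is_fun f x y -> app f u v -> app f u v' -> v = v'.
Proof.
  intros hf hv hv'; destruct (fun_dom hf hv) as [hu _].
  destruct hf as [_ hf]; destruct (hf u hu) as (v0 & _ & h).
  now rewrite <- (h v hv), <- (h v' hv').
Qed.

Lemma graph_exists (R : M -> M -> Prop) x :
  definable (fun e => R (e 0) (e 1)) ->
  (forall u v v', u ∈ x -> R u v -> R u v' -> v = v') ->
  exists f, is_set f /\
    (forall p, p ∈ f <-> exists u v, u ∈ x /\ R u v /\ p = opair u v) /\
    (forall u v, app f u v <-> u ∈ x /\ R u v).
Proof.
  intros hR hf.
  destruct (@replacement (fun u p => exists v, R u v /\ p = opair u v) x)
    as (f & hs & h).
  - apply def_ex, def_and.
    + exact (def_reindex (fun n => match n with 0 => 1 | _ => 0 end) hR).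
    + apply def_eq; [apply term_var | apply term_opair; apply term_var].
  - intros u p p' hu (v & hv & ->) (v' & hv' & ->); f_equal; eauto.
  - assert (hp : forall p, p ∈ f <-> exists u v, u ∈ x /\ R u v /\ p = opair u v).
    { intros p; rewrite h; split.
      - intros (u & hu & v & hv & ->); eauto 6.
      - intros (u & v & hu & hv & ->); eauto 6. }
    exists f; split; [exact hs | split; [exact hp|]].
    intros u v; rewrite appE, hp; split.
    + intros (u' & v' & hu & hv & e); apply opair_inj in e; destruct e; now subst.
    + intros [hu hv]; eauto 6.
Qed.

Lemma graph_is_fun (R : M -> M -> Prop) f x y :
  is_set f ->
  (forall p, p ∈ f <-> exists u v, u ∈ x /\ R u v /\ p = opair u v) ->
  (forall u v v', u ∈ x -> R u v -> R u v' -> v = v') ->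
  (forall u, u ∈ x -> exists v, v ∈ y /\ R u v) ->
  is_fun f x y.
Proof.
  intros hs hp hf ht; split; [split; [exact hs|]|].
  - intros p h; apply hp in h; destruct h as (u & v & hu & hv & ->).
    destruct (ht u hu) as (v' & hy & hv'); rewrite (hf u v v' hu hv hv').
    exists u, v'; rewrite is_opairE; auto.
  - intros u hu; destruct (ht u hu) as (v & hy & hv).
    exists v; split.
    + apply appE, hp; eauto 6.
    + intros v' h; apply appE, hp in h; destruct h as (u1 & v1 & hu1 & hv1 & e).
      apply opair_inj in e; destruct e; subst; eauto.
Qed.

(** * Foundation *)

Lemma mem_irrefl x : ~ x ∈ x.
Proof.
  intros h; destruct (zfa_foundation hM (x := pair x x)) as (y & hy & hn).
  - exists x; apply in_pair; auto.
  - apply in_pair in hy; assert (y = x) as -> by tauto.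
    apply (hn x); [apply in_pair; auto | exact h].
Qed.

Lemma mem_asym x y : x ∈ y -> y ∈ x -> False.
Proof.
  intros h h'; destruct (zfa_foundation hM (x := pair x y)) as (z & hz & hn).
  - exists x; apply in_pair; auto.
  - apply in_pair in hz; destruct hz as [->| ->].
    + apply (hn y); [apply in_pair; auto | exact h'].
    + apply (hn x); [apply in_pair; auto | exact h].
Qed.

End SetTheory.

#[export] Hint Resolve term_pair term_opair term_bigcup term_adjoin term_succ
  term_var term_const : terms.

(** * Natural numbers of the model *)

Section Omega.
Context {M : structure} {hM : ZFA M}.
Implicit Types (x y z u v w f p m n k : M).

Lemma is_inductiveE w :
  is_inductive w <-> void ∈ w /\ forall x, x ∈ w -> succ x ∈ w.
Proof.
  split.
  - intros ((z & hz & hw) & hs); apply is_emptyE in hz; subst.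
    split; [exact hw | intros x hx].
    destruct (hs x hx) as (s & e & h); apply is_succE in e; now subst.
  - intros [h0 hs]; split.
    + exists void; split; [now apply is_emptyE | exact h0].
    + intros x hx; exists (succ x); split; [now apply is_succE | auto].
Qed.

Lemma omega_exists : exists w : M, is_omega w.
Proof.
  destruct (zfa_infinity hM) as (i & hi).
  destruct (@separation M hM (fun n => forall v, is_inductive v -> n ∈ v) i)
    as (w & _ & h); [definability|].
  exists w; split.
  - apply is_inductiveE in hi as [h0 hs]; apply is_inductiveE; split.
    + apply h; split; [exact h0|]; intros v hv; apply is_inductiveE in hv as [hv _]; exact hv.
    + intros x hx; apply h in hx as [hx hv]; apply h; split; [auto|].
      intros v hv'; apply is_inductiveE in hv' as hv''; destruct hv'' as [_ hS]; auto.
  - intros v hv n hn; apply h in hn as [_ hn]; auto.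
Qed.

Definition omega : M := witness omega_exists.

Lemma is_omegaE w : is_omega w <-> w = omega.
Proof.
  assert (ho : is_omega omega) by apply (witnessP omega_exists).
  split; [|intros ->; exact ho]; intros hw.
  assert (hs : forall v, is_omega v -> is_set v).
  { intros v [hv _]; apply is_inductiveE in hv as [h _].
    exact (inhabited_is_set h). }
  apply set_ext; auto.
  destruct hw as [hi hw], ho as [hi' ho]; intros z; split;
    [apply hw | apply ho]; assumption.
Qed.

Lemma omega_inductive : is_inductive omega.
Proof. now apply is_omegaE. Qed.

Lemma omega0 : void ∈ omega.
Proof. apply is_inductiveE, omega_inductive. Qed.

Lemma omegaS n : n ∈ omega -> succ n ∈ omega.
Proof. apply is_inductiveE, omega_inductive. Qed.

Lemma nat_ind_def (P : M -> Prop) : definable (fun e => P (e 0)) ->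
  P void -> (forall n, n ∈ omega -> P n -> P (succ n)) ->
  forall n, n ∈ omega -> P n.
Proof.
  intros hP h0 hS n hn.
  destruct (separation omega hP) as (w & _ & hw).
  enough (hs : subset omega w) by (apply hw; exact (hs n hn)).
  apply (proj2 (is_omegaE omega) eq_refl).
  apply is_inductiveE; split.
  - apply hw; split; [apply omega0 | exact h0].
  - intros x hx; apply hw in hx as [hx px]; apply hw; split;
      [now apply omegaS | auto].
Qed.

Lemma nat_transitive n x : n ∈ omega -> x ∈ n -> subset x n.
Proof.
  intros hn; revert n hn x; apply (@nat_ind_def (fun n => forall x, x ∈ n -> subset x n)).
  - definability.
  - intros x hx; now apply in_void in hx.
  - intros n hn ih x hx z hz; apply in_succ; left.
    apply in_succ in hx as [hx| ->]; [exact (ih x hx z hz) | exact hz].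
Qed.

Lemma void_neq_succ x : void <> succ x.
Proof. intros h; apply (@in_void M hM x); rewrite h; apply in_succ; auto. Qed.

Lemma succ_inj x y : succ x = succ y -> x = y.
Proof.
  intros h.
  assert (h1 : x ∈ succ y) by (rewrite <- h; apply in_succ; auto).
  assert (h2 : y ∈ succ x) by (rewrite h; apply in_succ; auto).
  apply in_succ in h1, h2; destruct h1 as [h1|h1]; [|exact h1].
  destruct h2 as [h2|h2]; [|auto]; now destruct (mem_asym h1 h2).
Qed.

Lemma succ_mono m n : m ∈ omega -> n ∈ omega -> m ∈ n -> succ m ∈ succ n.
Proof.
  intros hm hn; revert n hn m hm.
  apply (@nat_ind_def (fun n => forall m, m ∈ omega -> m ∈ n -> succ m ∈ succ n)).
  - definability.
  - intros m _ h; now apply in_void in h.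
  - intros n hn ih m hm h; apply in_succ in h as [h| ->]; apply in_succ; auto.
Qed.

Lemma trichotomy m n : m ∈ omega -> n ∈ omega -> m ∈ n \/ m = n \/ n ∈ m.
Proof.
  intros hm hn; revert m hm.
  apply (@nat_ind_def (fun m => m ∈ n \/ m = n \/ n ∈ m)); [definability| |].
  - revert n hn; apply (@nat_ind_def (fun n => void ∈ n \/ void = n \/ n ∈ void)).
    + definability.
    + auto.
    + intros n _ [h|[<- |h]]; [left|left|now apply in_void in h]; apply in_succ; auto.
  - intros m hm [h|[->|h]]; rewrite !in_succ; auto.
    apply succ_mono in h; auto; apply in_succ in h as [h|h]; auto.
Qed.

Lemma nat_directed m n : m ∈ omega -> n ∈ omega ->
  exists k, k ∈ omega /\ subset m k /\ subset n k.
Proof.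
  intros hm hn; destruct (trichotomy hm hn) as [h|[->|h]].
  - exists n; repeat split; auto; [now apply nat_transitive | now intros z].
  - exists n; repeat split; auto; now intros z.
  - exists m; repeat split; auto; [now intros z | now apply nat_transitive].
Qed.

(** * Recursion on the natural numbers, transitive closures *)

Section Recursion.
Variables (x0 : M) (step : M -> M).
Hypothesis def_step : forall t, term t -> term (fun e => step (t e)).

(** Every pair in such a set traces back to the initial value.  Unlike the usual
    approximating functions, traced sets need neither be functional nor have a
    prescribed domain, and adjoining one pair extends them by one step. *)
Definition traced h : Prop := forall n v, opair n v ∈ h ->
  (n = void /\ v = x0) \/
  (exists m u, n = succ m /\ v = step u /\ opair m u ∈ h).

Definition recurs n v : Prop := exists h, traced h /\ opair n v ∈ h.

Lemma def_recurs s t : term s -> term t -> definable (fun e => recurs (s e) (t e)).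
Proof. intros hs ht; apply def_rel2; auto; definability. Qed.

Lemma recurs0 : recurs void x0.
Proof.
  exists (pair (opair void x0) (opair void x0)); split.
  - intros n v h; left; apply in_pair in h.
    destruct h as [h|h]; now apply opair_inj in h.
  - apply in_pair; auto.
Qed.

Lemma recursS n v : recurs n v -> recurs (succ n) (step v).
Proof.
  intros (h & ht & hv); exists (adjoin h (opair (succ n) (step v))); split.
  - intros m u hu; apply in_adjoin in hu as [hu|hu].
    + destruct (ht m u hu) as [c|(m' & u' & e & e' & h')]; [auto|right].
      exists m', u'; rewrite in_adjoin; auto.
    + apply opair_inj in hu as [-> ->]; right; exists n, v.
      rewrite in_adjoin; auto.
  - apply in_adjoin; auto.
Qed.

Lemma recurs_uniq n : n ∈ omega ->
  forall v v', recurs n v -> recurs n v' -> v = v'.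
Proof.
  revert n; apply (@nat_ind_def (fun n => forall v v', recurs n v -> recurs n v' -> v = v')).
  - definability; apply def_recurs; apply term_var.
  - intros v v' (h & ht & hv) (h' & ht' & hv').
    destruct (ht _ _ hv) as [[_ ->]|(m & u & e & _)]; [|now apply void_neq_succ in e].
    destruct (ht' _ _ hv') as [[_ ->]|(m & u & e & _)]; [auto|now apply void_neq_succ in e].
  - intros n hn ih v v' (h & ht & hv) (h' & ht' & hv').
    destruct (ht _ _ hv) as [[e _]|(m & u & e & -> & hu)].
    { symmetry in e; now apply void_neq_succ in e. }
    destruct (ht' _ _ hv') as [[e' _]|(m' & u' & e' & -> & hu')].
    { symmetry in e'; now apply void_neq_succ in e'. }
    apply succ_inj in e, e'; subst m m'; f_equal; apply ih.
    + now exists h.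
    + now exists h'.
Qed.

Lemma omega_recursion : exists f, is_set f /\
  (forall p, p ∈ f <-> exists n v, n ∈ omega /\ recurs n v /\ p = opair n v) /\
  (forall n v, app f n v <-> n ∈ omega /\ recurs n v).
Proof.
  apply graph_exists.
  - apply def_recurs; apply term_var.
  - intros u v v' hu; apply (recurs_uniq hu).
Qed.

End Recursion.

(** The union of the iterated unions of the singleton of [x]. *)
Lemma transitive_superset x : exists t, is_transitive t /\ x ∈ t.
Proof.
  destruct (@replacement M hM (fun n v => recurs (pair x x) bigcup n v) omega)
    as (r & _ & hr).
  - apply def_recurs; [apply term_bigcup | apply term_var | apply term_var].
  - intros u v v' hu; apply recurs_uniq; auto using term_bigcup.
  - exists (bigcup r); split; [split; [apply bigcup_set|]|].
    + intros y hy z hz; apply in_bigcup in hy as (v & hv & hy).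
      apply hr in hv as (n & hn & hv).
      apply in_bigcup; exists (bigcup v); split.
      * apply hr; exists (succ n); split; [now apply omegaS | now apply recursS].
      * apply in_bigcup; eauto.
    + apply in_bigcup; exists (pair x x); split; [|apply in_pair; auto].
      apply hr; exists void; split; [apply omega0 | apply recurs0].
Qed.

(** Foundation extends from sets to definable classes because every object lies
    in a transitive set. *)
Lemma mem_induction (P : M -> Prop) : definable (fun e => P (e 0)) ->
  (forall x, (forall y, y ∈ x -> P y) -> P x) -> forall x, P x.
Proof.
  intros hP ih x; apply NNPP; intros hx.
  destruct (transitive_superset x) as (t & [_ ht] & hxt).
  destruct (separation (P := fun y => ~ P y) t (def_not hP)) as (b & _ & hb).
  destruct (zfa_foundation hM (x := b)) as (y & hy & hmin).
  - exists x; apply hb; auto.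
  - apply hb in hy as [hyt hy]; apply hy, ih; intros z hz.
    apply NNPP; intros hnz; apply (hmin z); [|exact hz].
    apply hb; split; [exact (ht y hyt z hz) | exact hnz].
Qed.

End Omega.

(** * Permutations of the atoms acting on the universe *)

Section Action.
Context {M : structure} {hM : ZFA M}.
Implicit Types (x y z u v f p s t : M).

Definition atoms : M := witness (zfa_atom_set hM).

Lemma in_atoms x : x ∈ atoms <-> atom x.
Proof. apply (witnessP (zfa_atom_set hM)). Qed.

Lemma atoms_set : is_set atoms.
Proof. apply (witnessP (zfa_atom_set hM)). Qed.

Lemma is_atom_setE x : is_atom_set x <-> x = atoms.
Proof.
  split.
  - intros [hx h]; apply set_ext; [exact hx | apply atoms_set|].
    intros z; now rewrite h, in_atoms.
  - intros ->; split; [apply atoms_set | apply in_atoms].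
Qed.

Definition perm s : Prop := is_bij s atoms atoms.

Lemma perm_fun s : perm s -> is_fun s atoms atoms.
Proof. now intros [h _]. Qed.

Lemma perm_inj s x x' y : perm s -> app s x y -> app s x' y -> x = x'.
Proof. intros (_ & h & _); apply h. Qed.

Lemma perm_of_graph s (R : M -> M -> Prop) : is_set s ->
  (forall p, p ∈ s <-> exists u v, u ∈ atoms /\ R u v /\ p = opair u v) ->
  (forall u v v', atom u -> R u v -> R u v' -> v = v') ->
  (forall u u' v, atom u -> atom u' -> R u v -> R u' v -> u = u') ->
  (forall u, atom u -> exists v, atom v /\ R u v) ->
  (forall v, atom v -> exists u, atom u /\ R u v) ->
  perm s /\ (forall u v, app s u v <-> atom u /\ R u v).
Proof.
  intros hs hp hf hi ht hsur.
  assert (happ : forall u v, app s u v <-> atom u /\ R u v).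
  { intros u v; rewrite appE, hp; split.
    - intros (u' & v' & hu & hv & e); apply opair_inj in e as [-> ->].
      now apply in_atoms in hu.
    - intros [hu hv]; exists u, v; rewrite in_atoms; auto. }
  split; [|exact happ]; split; [|split].
  - apply (graph_is_fun hs hp).
    + intros u v v' hu; apply in_atoms in hu; now apply hf.
    + intros u hu; apply in_atoms in hu; destruct (ht u hu) as (v & hv & h).
      exists v; now rewrite in_atoms.
  - intros u u' v h h'; apply happ in h as [a h], h' as [a' h']; eauto.
  - intros v hv; apply in_atoms in hv; destruct (hsur v hv) as (u & hu & h).
    exists u; now apply happ.
Qed.

Lemma perm_id_exists : exists i, perm i /\ forall x y, app i x y <-> atom x /\ x = y.
Proof.
  destruct (@graph_exists M hM (fun x y => x = y) atoms) as (i & hi & hp & _).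
  - definability.
  - congruence.
  - exists i; apply (perm_of_graph hi hp); try congruence; eauto.
Qed.

Lemma perm_inverse_exists s : perm s ->
  exists t, perm t /\ forall x y, app t x y <-> app s y x.
Proof.
  intros hs.
  destruct (@graph_exists M hM (fun x y => app s y x) atoms) as (t & ht & hp & _).
  - definability.
  - intros u v v' _; now apply perm_inj.
  - destruct (perm_of_graph ht hp) as [h happ].
    + intros u v v' _; now apply perm_inj.
    + intros u u' v _ _; apply (fun_uniq (perm_fun hs)).
    + intros u hu; destruct hs as (hf & _ & hsur).
      destruct (hsur u) as (v & hv); [now apply in_atoms|].
      exists v; split; [apply in_atoms, (fun_dom hf hv) | exact hv].
    + intros u hu; destruct (fun_total (u := u) (perm_fun hs)) as (v & hv).
      { now apply in_atoms. }
      exists v; split; [apply in_atoms, (fun_dom (perm_fun hs) hv) | exact hv].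
    + exists t; split; [exact h|]; intros x y; rewrite happ.
      split; [tauto|]; intros hx; split; [|exact hx].
      apply in_atoms, (fun_dom (perm_fun hs) hx).
Qed.

Lemma perm_comp_exists s t : perm s -> perm t ->
  exists u, perm u /\ forall x z, app u x z <-> exists y, app t x y /\ app s y z.
Proof.
  intros hs ht; pose proof (perm_fun hs) as fs; pose proof (perm_fun ht) as ft.
  destruct (@graph_exists M hM (fun x z => exists y, app t x y /\ app s y z) atoms)
    as (u & hu & hp & _).
  - definability.
  - intros x z z' _ (y & h1 & h2) (y' & h1' & h2').
    rewrite (fun_uniq ft h1 h1') in h2; exact (fun_uniq fs h2 h2').
  - destruct (perm_of_graph hu hp) as [h happ].
    + intros x z z' _ (y & h1 & h2) (y' & h1' & h2').
      rewrite (fun_uniq ft h1 h1') in h2; exact (fun_uniq fs h2 h2').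
    + intros x x' z _ _ (y & h1 & h2) (y' & h1' & h2').
      rewrite (perm_inj hs h2 h2') in h1; exact (perm_inj ht h1 h1').
    + intros x hx; apply in_atoms in hx.
      destruct (fun_total ft hx) as (y & hy).
      destruct (fun_total fs (proj2 (fun_dom ft hy))) as (z & hz).
      exists z; split; [apply in_atoms, (fun_dom fs hz) | now exists y].
    + intros z hz; apply in_atoms in hz.
      destruct (proj2 (proj2 hs) z hz) as (y & hy).
      destruct (proj2 (proj2 ht) y (proj1 (fun_dom fs hy))) as (x & hx).
      exists x; split; [apply in_atoms, (fun_dom ft hx) | now exists y].
    + exists u; split; [exact h|]; intros x z; rewrite happ; split; [tauto|].
      intros (y & hy & hz); split; [apply in_atoms, (fun_dom ft hy) | now exists y].
Qed.

Section ActGraph.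
Variable s : M.
Hypothesis hs : perm s.

(** Where two witnessing functions overlap they agree, by induction on
    membership; their domains may be different. *)
Lemma act_uniq x : forall y y', act s x y -> act s x y' -> y = y'.
Proof.
  revert x; apply (@mem_induction M hM
    (fun x => forall y y', act s x y -> act s x y' -> y = y')); [definability|].
  intros x ih y y' (t & r & f & ht & hxt & hf & hc & hxy)
    (t' & r' & f' & ht' & hxt' & hf' & hc' & hxy').
  destruct (hc x y hxy) as [ha hset], (hc' x y' hxy') as [ha' hset'].
  destruct (classic (atom x)) as [hx|hx].
  - exact (fun_uniq (perm_fun hs) (ha hx) (ha' hx)).
  - destruct (hset hx) as [sy hy], (hset' hx) as [sy' hy'].
    assert (heq : forall z v v', z ∈ x -> app f z v -> app f' z v' -> v = v').
    { intros z v v' hz hv hv'; apply (ih z hz).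
      - exists t, r, f; split; [exact ht | split; [apply (proj2 ht x)|]]; auto.
      - exists t', r', f'; split; [exact ht' | split; [apply (proj2 ht' x)|]]; auto. }
    apply set_ext; auto; intros u; rewrite hy, hy'; split; intros (z & hz & hu).
    + destruct (fun_total hf' (proj2 ht' x hxt' z hz)) as (v & hv).
      rewrite (heq z u v hz hu hv); eauto.
    + destruct (fun_total hf (proj2 ht x hxt z hz)) as (v & hv).
      rewrite <- (heq z v u hz hv hu); eauto.
Qed.

Lemma act_mem x y z : act s x y -> z ∈ x -> exists u, act s z u.
Proof.
  intros (t & r & f & ht & hxt & hf & hc & hxy) hz.
  assert (hzt : z ∈ t) by (apply (proj2 ht x); auto).
  destruct (fun_total hf hzt) as (u & hu); exists u, t, r, f; auto 7.
Qed.

Lemma act_atom x y : act s x y -> atom x -> app s x y.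
Proof. intros (t & r & f & ht & hxt & hf & hc & hxy); now apply (hc x y). Qed.

(** The clause of the recursion refers to one witnessing function; uniqueness
    frees it from that function. *)
Lemma act_set x y : act s x y -> is_set x ->
  is_set y /\ forall u, u ∈ y <-> exists z, z ∈ x /\ act s z u.
Proof.
  intros (t & r & f & ht & hxt & hf & hc & hxy) hx.
  destruct (hc x y hxy) as [_ h]; destruct (h hx) as [hy hu].
  split; [exact hy|]; intros u; rewrite hu; clear h hu.
  assert (hact : forall z v, z ∈ x -> app f z v -> act s z v).
  { intros z v hz hv; exists t, r, f.
    split; [exact ht | split; [apply (proj2 ht x)|]]; auto. }
  split; intros (z & hz & hu); exists z; split; auto.
  destruct (fun_total hf (proj2 ht x hxt z hz)) as (v & hv).
  now rewrite (act_uniq hu (hact z v hz hv)).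
Qed.

(** For the step at [x], the witnessing function lives on the part [D] of a
    transitive set on which the action is already known to be defined, extended by
    [x] itself.  By the induction hypothesis [D] contains the elements of [x]; if
    it contained [x], nothing would be left to prove. *)
Lemma act_total x : exists y, act s x y.
Proof.
  revert x; apply (@mem_induction M hM (fun x => exists y, act s x y)); [definability|].
  intros x ih.
  destruct (classic (exists y, act s x y)) as [hx|hx]; [exact hx|].
  assert (hy : exists y, (atom x -> app s x y) /\
    (is_set x -> is_set y /\ forall u, u ∈ y <-> exists z, z ∈ x /\ act s z u)).
  { destruct (classic (atom x)) as [a|a].
    - destruct (fun_total (u := x) (perm_fun hs)) as (y & hy).
      { now apply in_atoms. }
      exists y; split; [auto | contradiction].
    - destruct (@replacement M hM (act s) x) as (y & hy).
      { definability. }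
      { intros u v v' _; apply act_uniq. }
      exists y; split; [contradiction | auto]. }
  destruct hy as (y & hya & hys).
  destruct (transitive_superset x) as (T & [_ hT] & hxT).
  destruct (@separation M hM (fun z => exists u, act s z u) T) as (D & hD & inD).
  { definability. }
  set (R z u := act s z u \/ (z = x /\ u = y)).
  assert (defR : definable (fun e : nat -> M => R (e 0) (e 1))).
  { unfold R; definability. }
  set (t := adjoin D x).
  assert (Rx : forall u, R x u -> u = y).
  { intros u [h|h]; [destruct hx; now exists u | tauto]. }
  assert (RD : forall z u, z ∈ D -> (R z u <-> act s z u)).
  { intros z u hz; split; [|now left]; intros [h|[-> _]]; [exact h|].
    apply inD in hz; destruct (hx (proj2 hz)). }
  assert (funR : forall z u u', z ∈ t -> R z u -> R z u' -> u = u').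
  { intros z u u' hz h h'; apply in_adjoin in hz as [hz| ->].
    - rewrite RD in h, h' by exact hz; exact (act_uniq h h').
    - now rewrite (Rx u h), (Rx u' h'). }
  assert (totR : forall z, z ∈ t -> exists u, R z u).
  { intros z hz; apply in_adjoin in hz as [hz| ->].
    - apply inD in hz as [_ (u & hu)]; exists u; now left.
    - exists y; now right. }
  assert (downD : forall z z', z ∈ D -> z' ∈ z -> z' ∈ D).
  { intros z z' hz hz'; apply inD in hz as [hz (u & hu)]; apply inD.
    split; [exact (hT z hz z' hz') | exact (act_mem hu hz')]. }
  assert (xD : forall z, z ∈ x -> z ∈ D).
  { intros z hz; apply inD; split; [exact (hT x hxT z hz) | now apply ih]. }
  destruct (graph_exists defR funR) as (f & hf & hfp & hfa).
  destruct (replacement defR funR) as (r & hr & inr).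
  exists y, t, r, f; split; [|split; [|split; [|split]]].
  - split; [apply adjoin_set|]; intros z hz z' hz'; apply in_adjoin; left.
    apply in_adjoin in hz as [hz| ->]; [exact (downD z z' hz hz') | auto].
  - apply in_adjoin; auto.
  - apply (graph_is_fun hf hfp funR); intros z hz.
    destruct (totR z hz) as (u & hu); exists u; split; [apply inr; eauto | exact hu].
  - assert (hfD : forall z u, z ∈ D -> (app f z u <-> act s z u)).
    { intros z u hz; rewrite hfa, <- RD by exact hz; split; [tauto|].
      split; [apply in_adjoin; auto | auto]. }
    intros z v hzv; apply hfa in hzv as [hz hzv].
    apply in_adjoin in hz as [hz| ->].
    + apply RD in hzv; [|exact hz]; split; [now apply act_atom|]; intros hsz.
      destruct (act_set hzv hsz) as [hv h]; split; [exact hv|]; intros u.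
      rewrite h; split; intros (z' & hz' & hu); exists z';
        (split; [exact hz' | apply (hfD z' u (downD z z' hz hz')); exact hu]).
    + rewrite (Rx v hzv); split; [exact hya|]; intros hsx.
      destruct (hys hsx) as [hv h]; split; [exact hv|]; intros u.
      rewrite h; split; intros (z' & hz' & hu); exists z';
        (split; [exact hz' | apply (hfD z' u (xD z' hz')); exact hu]).
  - apply hfa; split; [apply in_adjoin; auto | now right].
Qed.

End ActGraph.

(** The object [s[x]]; the value [x] for the other [s] is arbitrary. *)
Definition image s x : M :=
  match excluded_middle_informative (exists y, act s x y) with
  | left h => witness h
  | right _ => x
  end.

Lemma actE s x y : perm s -> (act s x y <-> y = image s x).
Proof.
  intros hs; unfold image.
  destruct excluded_middle_informative as [h|h]; [|destruct h; now apply act_total].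
  pose proof (witnessP h) as hw; split; [|now intros ->].
  intros hy; exact (act_uniq hs hy hw).
Qed.

Lemma image_act s x : perm s -> act s x (image s x).
Proof. intros hs; now apply actE. Qed.

Lemma term_image s (t : (nat -> M) -> M) : perm s -> term t -> term (fun e => image s (t e)).
Proof.
  intros hs; apply (@term_graph1 M (fun y x => act s x y) (image s)).
  - definability.
  - intros x y; now apply actE.
Qed.

Lemma image_atom s x : perm s -> atom x -> app s x (image s x).
Proof. intros hs; apply act_atom, image_act, hs. Qed.

Lemma image_app s x y : perm s -> app s x y -> image s x = y.
Proof.
  intros hs h; apply (fun_uniq (perm_fun hs) (u := x)); [|exact h].
  apply image_atom; [exact hs|]; apply in_atoms, (fun_dom (perm_fun hs) h).
Qed.

Lemma atom_image s x : perm s -> atom x -> atom (image s x).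
Proof.
  intros hs hx; apply in_atoms, (fun_dom (perm_fun hs) (image_atom hs hx)).
Qed.

(** The maps of the universe that send a set to the set of the values of its
    elements; they are determined by their values at the atoms. *)
Definition elementwise (F : M -> M) : Prop :=
  (forall t : (nat -> M) -> M, term t -> term (fun e => F (t e))) /\
  (forall x, atom x -> atom (F x)) /\
  (forall x, is_set x ->
     is_set (F x) /\ forall u, u ∈ F x <-> exists z, z ∈ x /\ u = F z).

Lemma elementwise_id : elementwise (fun x => x).
Proof.
  split; [auto|split; [auto|]]; intros x hx; split; [auto|]; intros u.
  split; [eauto | intros (z & hz & ->); exact hz].
Qed.

Lemma elementwise_image s : perm s -> elementwise (image s).
Proof.
  intros hs; split; [intros t; now apply term_image|].
  split; [intros x; now apply atom_image|]; intros x hx.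
  destruct (act_set hs (image_act x hs) hx) as [h h']; split; [exact h|].
  intros u; rewrite h'; split; intros (z & hz & hu); exists z; split; auto;
    now apply (actE z u hs).
Qed.

Lemma elementwise_comp F G : elementwise F -> elementwise G ->
  elementwise (fun x => F (G x)).
Proof.
  intros (tF & aF & sF) (tG & aG & sG); split; [auto|split; [auto|]].
  intros x hx; destruct (sG x hx) as [hG iG], (sF _ hG) as [hF iF].
  split; [exact hF|]; intros u; rewrite iF; split.
  - intros (z & hz & ->); apply iG in hz as (y & hy & ->); eauto.
  - intros (y & hy & ->); exists (G y); rewrite iG; eauto.
Qed.

Lemma elementwise_ext F G : elementwise F -> elementwise G ->
  (forall x, atom x -> F x = G x) -> forall x, F x = G x.
Proof.
  intros (tF & aF & sF) (tG & aG & sG) ha.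
  apply (@mem_induction M hM (fun x => F x = G x)); [definability; auto using term_var|].
  intros x ih; destruct (classic (atom x)) as [hx|hx]; [auto|].
  destruct (sF x hx) as [hF iF], (sG x hx) as [hG iG].
  apply set_ext; auto; intros u; rewrite iF, iG; split; intros (z & hz & ->);
    exists z; split; auto; rewrite ih; auto.
Qed.

(** Each of the next four identities holds at the atoms and extends from there by
    [elementwise_ext]. *)
Lemma image_id i x : perm i -> (forall y z, app i y z -> y = z) -> image i x = x.
Proof.
  intros hi h; revert x.
  apply (elementwise_ext (elementwise_image hi) elementwise_id).
  intros x hx; symmetry; apply h, image_atom; assumption.
Qed.

Lemma image_comp u s t x : perm u -> perm s -> perm t ->
  is_comp u s t -> image u x = image s (image t x).
Proof.
  intros hu hs ht h; revert x.
  apply (elementwise_ext (G := fun x => image s (image t x)) (elementwise_image hu)).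
  - apply elementwise_comp; now apply elementwise_image.
  - intros x hx; apply image_app; [exact hu|].
    apply (h x (image t x)); apply image_atom; auto using atom_image.
Qed.

Lemma image_commute s t x : perm s -> perm t ->
  (forall y, atom y -> image s (image t y) = image t (image s y)) ->
  image s (image t x) = image t (image s x).
Proof.
  intros hs ht h; revert x.
  apply (@elementwise_ext (fun x => image s (image t x)) (fun x => image t (image s x)));
    auto using elementwise_comp, elementwise_image.
Qed.

Lemma image_inverse t s x : perm s -> perm t -> is_inverse t s ->
  image t (image s x) = x.
Proof.
  intros hs ht h; revert x.
  apply (@elementwise_ext (fun x => image t (image s x)) (fun x => x));
    auto using elementwise_comp, elementwise_image, elementwise_id.
  intros x hx; apply image_app; [exact ht|]; apply h; now apply image_atom.
Qed.

Lemma image_inj s x y : perm s -> image s x = image s y -> x = y.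
Proof.
  intros hs h; destruct (perm_inverse_exists hs) as (t & ht & hts).
  assert (hi : is_inverse t s) by (intros u v; now apply hts).
  now rewrite <- (image_inverse x hs ht hi), h, image_inverse.
Qed.

Lemma image_set s x : perm s -> is_set x -> is_set (image s x).
Proof. intros hs hx; now apply (elementwise_image hs). Qed.

Lemma in_image s x u : perm s -> (u ∈ image s x <-> exists z, z ∈ x /\ u = image s z).
Proof.
  intros hs; destruct (classic (atom x)) as [hx|hx].
  - split; [|intros (z & hz & _); now apply (zfa_atoms hM) in hz].
    intros hu; exfalso; exact (zfa_atoms hM (atom_image hs hx) hu).
  - now apply (elementwise_image hs).
Qed.

Lemma mem_image s x z : perm s -> (image s z ∈ image s x <-> z ∈ x).
Proof.
  intros hs; rewrite in_image by exact hs; split; [|eauto].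
  intros (z' & hz & e); apply image_inj in e; now subst.
Qed.

Lemma image_pair s x y : perm s -> image s (pair x y) = pair (image s x) (image s y).
Proof.
  intros hs; apply set_ext; [apply image_set, pair_set; exact hs | apply pair_set|].
  intros u; rewrite in_image, in_pair by exact hs; split.
  - intros (z & hz & ->); apply in_pair in hz as [-> | ->]; auto.
  - intros [-> | ->]; [exists x | exists y]; rewrite in_pair; auto.
Qed.

Lemma image_opair s x y : perm s ->
  image s (opair x y) = opair (image s x) (image s y).
Proof. intros hs; unfold opair; now rewrite !image_pair. Qed.

Lemma app_image s f x y : perm s ->
  (app (image s f) (image s x) (image s y) <-> app f x y).
Proof. intros hs; rewrite !appE, <- image_opair by exact hs; now apply mem_image. Qed.

End Action.

#[export] Hint Resolve term_image : terms.

(** * Finite sets of the model *)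

Section Finite.
Context {M : structure} {hM : ZFA M}.
Implicit Types (x y z u v f n c : M).

Lemma is_finiteE x : is_finite x <->
  is_set x /\ exists n f, n ∈ omega /\ is_bij f n x.
Proof.
  split; intros [hx h]; (split; [exact hx|]).
  - destruct h as (w & n & f & hw & hn & hf); apply is_omegaE in hw; subst; eauto.
  - destruct h as (n & f & hn & hf); exists omega, n, f; now rewrite is_omegaE.
Qed.

Lemma finite_void : is_finite void.
Proof.
  apply is_finiteE; split; [apply void_set|].
  assert (ha : forall u v, ~ app void u v)
    by (intros u v h; apply appE in h; now apply in_void in h).
  exists void, void; split; [apply omega0|split; [split; [split|]|split]].
  - apply void_set.
  - intros p hp; now apply in_void in hp.
  - intros u hu; now apply in_void in hu.
  - intros u u' v h; now apply ha in h.
  - intros v hv; now apply in_void in hv.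
Qed.

Lemma finite_adjoin x c : is_finite x -> is_finite (adjoin x c).
Proof.
  intros hx; destruct (classic (c ∈ x)) as [hc|hc].
  { replace (adjoin x c) with x; [exact hx|].
    apply set_ext; [apply hx | apply adjoin_set|]; intros z; rewrite in_adjoin.
    split; [auto | intros [h| ->]; auto]. }
  apply is_finiteE in hx as [hx (n & f & hn & hf & hi & hs)].
  apply is_finiteE; split; [apply adjoin_set|].
  exists (succ n), (adjoin f (opair n c)); split; [now apply omegaS|].
  assert (ha : forall u v, app (adjoin f (opair n c)) u v <->
                           app f u v \/ (u = n /\ v = c)).
  { intros u v; rewrite !appE, in_adjoin; split; intros [h|h]; auto; right.
    - now apply opair_inj in h.
    - now destruct h as [-> ->]. }
  assert (hnf : forall v, ~ app f n v).
  { intros v h; apply (fun_dom hf) in h as [h _]; now apply mem_irrefl in h. }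
  assert (hcf : forall u, ~ app f u c).
  { intros v h; apply (fun_dom hf) in h as [_ h]; now apply hc. }
  split; [split; [split; [apply adjoin_set|]|]|split].
  - intros p hp; apply in_adjoin in hp as [hp| ->].
    + destruct (proj2 (proj1 hf) p hp) as (u & v & hu & hv & e).
      exists u, v; rewrite in_succ, in_adjoin; auto.
    + exists n, c; rewrite in_succ, in_adjoin, is_opairE; auto.
  - intros u hu; apply in_succ in hu as [hu| ->].
    + destruct (fun_total hf hu) as (v & hv); exists v; split; [apply ha; auto|].
      intros v' h; apply ha in h as [h|[-> _]].
      * exact (fun_uniq hf hv h).
      * now apply mem_irrefl in hu.
    + exists c; split; [apply ha; auto|].
      intros v' h; apply ha in h as [h|[_ ->]]; [now apply hnf in h | auto].
  - intros u u' v h h'; apply ha in h, h'; destruct h as [h|[-> ->]], h' as [h'|[-> h']].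
    + exact (hi u u' v h h').
    + subst; now apply hcf in h.
    + now apply hcf in h'.
    + reflexivity.
  - intros v hv; apply in_adjoin in hv as [hv| ->].
    + destruct (hs v hv) as (u & hu); exists u; apply ha; auto.
    + exists n; apply ha; auto.
Qed.

(** Finiteness is measured by the natural numbers of the model, so that induction
    runs over the images of the initial segments of a witnessing enumeration. *)
Lemma finite_ind (P : M -> Prop) : definable (fun e => P (e 0)) ->
  P void -> (forall x c, P x -> P (adjoin x c)) -> forall x, is_finite x -> P x.
Proof.
  intros hP h0 hS x hx; apply is_finiteE in hx as [hx (n & f & hn & hf & hi & hs)].
  assert (h : forall j, j ∈ omega -> subset j n -> exists y, is_set y /\
            (forall v, v ∈ y <-> exists i, i ∈ j /\ app f i v) /\ P y).
  { apply (@nat_ind_def M hM (fun j => subset j n -> exists y, is_set y /\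
            (forall v, v ∈ y <-> exists i, i ∈ j /\ app f i v) /\ P y)).
    - definability; apply def_rel1; [exact hP | apply term_var].
    - intros _; exists void; split; [apply void_set|split; [|exact h0]].
      intros v; split; [intros hv; now apply in_void in hv|].
      intros (i & h & _); now apply in_void in h.
    - intros j hj ih hs'; destruct ih as (y & hy & inY & py).
      { intros i h; apply hs', in_succ; auto. }
      destruct (fun_total (u := j) hf) as (c & hc).
      { apply hs', in_succ; auto. }
      exists (adjoin y c); split; [apply adjoin_set|split; [|auto]].
      intros v; rewrite in_adjoin, inY; split.
      + intros [(i & h & h')| ->].
        * exists i; rewrite in_succ; auto.
        * exists j; rewrite in_succ; auto.
      + intros (i & h & h'); apply in_succ in h as [h| ->]; [eauto|].
        right; exact (fun_uniq hf h' hc). }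
  destruct (h n hn (fun z hz => hz)) as (y & hy & inY & py).
  replace x with y; [exact py|]; apply set_ext; auto; intros v; rewrite inY; split.
  - intros (i & _ & hv); apply (fun_dom hf hv).
  - intros hv; destruct (hs v hv) as (i & h'); exists i; split; [|exact h'].
    apply (fun_dom hf h').
Qed.

Lemma finite_cup x y : is_finite x -> is_finite y -> is_finite (cup x y).
Proof.
  intros hx hy; revert y hy; apply (@finite_ind (fun y => is_finite (cup x y))).
  - apply (@def_rel1 M is_finite); [definability|].
    apply term_bigcup, term_pair; [apply term_const | apply term_var].
  - replace (cup x void) with x; [exact hx|].
    apply set_ext; [apply hx | apply cup_set|]; intros z; rewrite in_cup.
    split; [auto|]; intros [h|h]; [exact h | now apply in_void in h].
  - intros y c h; replace (cup x (adjoin y c)) with (adjoin (cup x y) c);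
      [now apply finite_adjoin|].
    apply set_ext; [apply adjoin_set | apply cup_set|]; intros z.
    rewrite !in_adjoin, !in_cup, in_adjoin; tauto.
Qed.

End Finite.

(** * The doubling function *)

Section Doubling.
Context {M : structure} {hM : ZFA M}.
Implicit Types (x y z u v f n k m j d : M).

Lemma doubling_exists : exists d, is_doubling omega d.
Proof.
  set (step k := succ (succ k)).
  assert (hstep : forall t : (nat -> M) -> M, term t -> term (fun e => step (t e)))
    by (intros; unfold step; auto using term_succ).
  destruct (@omega_recursion M hM void step hstep) as (d & hd & hp & happ).
  assert (hval : forall n, n ∈ omega -> exists v, v ∈ omega /\ recurs void step n v).
  { apply nat_ind_def.
    - definability; apply def_recurs; auto; apply term_var.
    - exists void; split; [apply omega0 | apply recurs0].
    - intros n _ (v & hv & hr); exists (step v); split;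
        [now apply omegaS, omegaS | now apply recursS]. }
  exists d; split; [|split].
  - apply (graph_is_fun hd hp); [|exact hval].
    intros u v v' hu; now apply recurs_uniq.
  - intros z hz; apply is_emptyE in hz as ->; apply happ; split;
      [apply omega0 | apply recurs0].
  - intros n n' k k' k'' hn e hk e' e''.
    apply is_succE in e, e', e''; subst.
    apply happ in hk as [_ hk]; apply happ; split; [now apply omegaS|].
    now apply recursS in hk.
Qed.

Lemma doubling0 d : is_doubling omega d -> app d void void.
Proof. intros (_ & h & _); apply h; now apply is_emptyE. Qed.

Lemma doublingS d n k : is_doubling omega d -> app d n k ->
  app d (succ n) (succ (succ k)).
Proof.
  intros (hf & _ & h) hk; apply (h n _ k (succ k)); try (now apply is_succE); auto.
  apply (fun_dom hf hk).
Qed.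

Lemma doubling_val d n k : is_doubling omega d -> app d n k ->
  n ∈ omega /\ k ∈ omega.
Proof. intros (hf & _) h; exact (fun_dom hf h). Qed.

Lemma doubling_uniq d n k k' : is_doubling omega d -> app d n k -> app d n k' -> k = k'.
Proof. intros (hf & _); apply (fun_uniq hf). Qed.

Lemma doubling_total d n : is_doubling omega d -> n ∈ omega -> exists k, app d n k.
Proof. intros (hf & _); apply (fun_total hf). Qed.

Lemma doubling_unique d d' n k : is_doubling omega d -> is_doubling omega d' ->
  app d n k -> app d' n k.
Proof.
  intros hd hd' hk; pose proof (proj1 (doubling_val hd hk)) as hn; revert n hn k hk.
  apply (@nat_ind_def M hM (fun n => forall k, app d n k -> app d' n k)); [definability| |].
  - intros k hk; rewrite (doubling_uniq hd hk (doubling0 hd)); now apply doubling0.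
  - intros n hn ih k hk; destruct (doubling_total hd hn) as (j & hj).
    rewrite (doubling_uniq hd hk (doublingS hd hj)); now apply doublingS, ih.
Qed.

(** Hence the atoms of the pair with number [n] have indices not below [n]. *)
Lemma doubling_ge d n k : is_doubling omega d -> app d n k -> subset n k.
Proof.
  intros hd hk; pose proof (proj1 (doubling_val hd hk)) as hn; revert n hn k hk.
  apply (@nat_ind_def M hM (fun n => forall k, app d n k -> subset n k)); [definability| |].
  - intros k _ z hz; now apply in_void in hz.
  - intros n hn ih k hk z hz; destruct (doubling_total hd hn) as (j & hj).
    rewrite (doubling_uniq hd hk (doublingS hd hj)); rewrite in_succ.
    apply in_succ in hz as [hz| ->]; [left; apply in_succ; left; exact (ih j hj z hz)|].
    left; apply in_succ; destruct (doubling_val hd hj) as [_ hjo].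
    destruct (trichotomy hn hjo) as [h|[h|h]]; auto.
    destruct (mem_irrefl (ih j hj j h)).
Qed.

(** Hence distinct pairs are disjoint. *)
Lemma doubling_mono d m n j k : is_doubling omega d -> app d m j -> app d n k ->
  m ∈ n -> succ j ∈ k.
Proof.
  intros hd hj hk; pose proof (proj1 (doubling_val hd hk)) as hn; revert n hn k hk.
  apply (@nat_ind_def M hM (fun n => forall k, app d n k -> m ∈ n -> succ j ∈ k)).
  - definability.
  - intros k _ h; now apply in_void in h.
  - intros n hn ih k hk h; destruct (doubling_total hd hn) as (i & hi).
    rewrite (doubling_uniq hd hk (doublingS hd hi)); apply in_succ.
    apply in_succ in h as [h| ->]; [left; apply in_succ; left; auto|].
    now rewrite (doubling_uniq hd hj hi); right.
Qed.

(** Hence every atom lies in a pair. *)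
Lemma doubling_cover d i : is_doubling omega d -> i ∈ omega ->
  exists n k, app d n k /\ (i = k \/ i = succ k).
Proof.
  intros hd; revert i; apply (@nat_ind_def M hM (fun i =>
    exists n k, app d n k /\ (i = k \/ i = succ k))); [definability| |].
  - exists void, void; split; [now apply doubling0 | auto].
  - intros i hi (n & k & hk & [->| ->]); [exists n, k; auto|].
    exists (succ n), (succ (succ k)); split; [now apply doublingS | auto].
Qed.

End Doubling.

(** * The group preserving the pairs *)

Section Frankel.
Context {M : structure} {hM : ZFA M}.
Implicit Types (x y z u v f p s t n k m j d i C K H : M).
Variables a Sigma F : M.
Hypothesis ha : is_bij a omega atoms.
Hypothesis hSigma : is_pair_group omega atoms a Sigma.
Hypothesis hF : is_atom_stab_filter a Sigma F.

Lemma enum_val i x : app a i x -> i ∈ omega /\ atom x.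
Proof.
  intros h; destruct (fun_dom (proj1 ha) h); now rewrite <- in_atoms.
Qed.

Lemma enum_total i : i ∈ omega -> exists x, app a i x.
Proof. apply (fun_total (proj1 ha)). Qed.

Lemma enum_uniq i x y : app a i x -> app a i y -> x = y.
Proof. apply (fun_uniq (proj1 ha)). Qed.

Lemma enum_inj i j x : app a i x -> app a j x -> i = j.
Proof. apply ha. Qed.

Lemma enum_onto x : atom x -> exists i, app a i x.
Proof. intros hx; apply ha; now apply in_atoms. Qed.

Lemma is_atom_pairE d p : is_doubling omega d ->
  (is_atom_pair omega a p <-> exists n k x y,
     app d n k /\ app a k x /\ app a (succ k) y /\ p = pair x y).
Proof.
  intros hd; split.
  - intros (d' & n & k & k' & x & y & hd' & hk & hs & hx & hy & hp).
    apply is_succE in hs; apply is_pairE in hp; subst.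
    exists n, k, x, y; repeat split; auto; exact (doubling_unique hd' hd hk).
  - intros (n & k & x & y & hk & hx & hy & ->).
    exists d, n, k, (succ k), x, y; rewrite is_succE, is_pairE; auto 7.
Qed.

Lemma atom_in_pair x : atom x -> exists y, is_atom_pair omega a (pair x y).
Proof.
  intros hx; destruct (enum_onto hx) as (i & hi).
  destruct (doubling_exists (M := M)) as (d & hd).
  destruct (doubling_cover hd (proj1 (enum_val hi))) as (n & k & hk & hik).
  destruct (doubling_val hd hk) as [_ hko].
  destruct hik as [-> | ->].
  - destruct (enum_total (omegaS hko)) as (y & hy); exists y.
    apply (is_atom_pairE _ hd); exists n, k, x, y; auto.
  - destruct (enum_total hko) as (y & hy); exists y.
    apply (is_atom_pairE _ hd); exists n, k, y, x; rewrite pairC; auto.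
Qed.

Lemma in_Sigma s :
  s ∈ Sigma <-> perm s /\ forall p, is_atom_pair omega a p -> image s p = p.
Proof.
  rewrite (proj2 hSigma s); split; intros [hs h]; (split; [exact hs|]); intros p hp.
  - symmetry; now apply (actE p p hs), h.
  - apply (actE p p hs); symmetry; auto.
Qed.

Lemma Sigma_perm s : s ∈ Sigma -> perm s.
Proof. intros h; now apply in_Sigma in h. Qed.

Lemma Sigma_id : exists i, i ∈ Sigma /\ forall x y, app i x y -> x = y.
Proof.
  destruct (perm_id_exists (M := M)) as (i & hi & hid).
  assert (hid' : forall x y, app i x y -> x = y) by (intros x y h; now apply hid in h).
  exists i; split; [|exact hid']; apply in_Sigma; split; [exact hi|].
  intros p _; now apply image_id.
Qed.

Lemma Sigma_comp s t : s ∈ Sigma -> t ∈ Sigma ->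
  exists u, u ∈ Sigma /\ is_comp u s t.
Proof.
  intros hs ht; apply in_Sigma in hs as [hs ps], ht as [ht pt].
  destruct (perm_comp_exists hs ht) as (u & hu & happ).
  assert (hc : is_comp u s t) by (intros x y z h h'; apply happ; eauto).
  exists u; split; [|exact hc]; apply in_Sigma; split; [exact hu|].
  intros p hp; rewrite (image_comp p hu hs ht hc), pt, ps; auto.
Qed.

Lemma Sigma_inverse s : s ∈ Sigma -> exists t, t ∈ Sigma /\ is_inverse t s.
Proof.
  intros hs; apply in_Sigma in hs as [hs ps].
  destruct (perm_inverse_exists hs) as (t & ht & happ).
  assert (hi : is_inverse t s) by (intros x y h; now apply happ).
  exists t; split; [|exact hi]; apply in_Sigma; split; [exact ht|].
  intros p hp; rewrite <- (ps p hp) at 1; now apply image_inverse.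
Qed.

Lemma pair_eq_cases x y u v : pair x y = pair u v ->
  (x = u /\ y = v) \/ (x = v /\ y = u).
Proof.
  intros h; assert (hx : x ∈ pair u v) by (rewrite <- h, in_pair; auto).
  apply in_pair in hx as [-> | ->].
  - left; split; [reflexivity | exact (pair_cancel h)].
  - right; split; [reflexivity|]; rewrite (pairC u v) in h; exact (pair_cancel h).
Qed.

(** Each element either fixes or exchanges the two members of a pair. *)
Lemma Sigma_commute s t x : s ∈ Sigma -> t ∈ Sigma ->
  image s (image t x) = image t (image s x).
Proof.
  intros hs ht; apply in_Sigma in hs as [hs ps], ht as [ht pt].
  apply image_commute; auto; clear x; intros x hx.
  destruct (atom_in_pair hx) as (y & hp).
  generalize (ps _ hp) (pt _ hp); rewrite !image_pair by assumption.
  intros hxs hxt; apply pair_eq_cases in hxs, hxt.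
  destruct hxs as [[e1 e2]|[e1 e2]], hxt as [[e3 e4]|[e3 e4]]; congruence.
Qed.

(** * Supports *)

(** The finite families of stabilizers of atoms stand in for the members of the
    filter that they generate; the union of two families then plays the part of
    the intersection of two subgroups. *)
Definition base C : Prop := is_finite C /\
  forall K, K ∈ C -> exists i x, app a i x /\ is_stab Sigma x K.

Definition fixer C s : Prop := s ∈ Sigma /\ forall K, K ∈ C -> s ∈ K.

Lemma in_stab x K s : is_stab Sigma x K -> (s ∈ K <-> s ∈ Sigma /\ image s x = x).
Proof.
  intros [_ hK]; rewrite hK; split; intros [hs h]; (split; [exact hs|]).
  - symmetry; now apply (actE x x (Sigma_perm hs)).
  - apply (actE x x (Sigma_perm hs)); auto.
Qed.

Lemma stab_exists x : exists K, is_stab Sigma x K.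
Proof.
  destruct (@separation M hM (fun s => act s x x) Sigma) as (K & hK & inK);
    [definability | now exists K].
Qed.

Lemma stab_subgroup x K : is_stab Sigma x K -> is_subgroup K Sigma.
Proof.
  intros hK; split; [apply hK|split; [|split; [|split]]].
  - intros s hs; now apply (in_stab s hK) in hs.
  - destruct Sigma_id as (i & hi & hid); exists i; split; [|exact hid].
    apply (in_stab i hK); split; [exact hi|]; apply image_id; auto using Sigma_perm.
  - intros s t hs ht; apply (in_stab s hK) in hs as [hs es].
    apply (in_stab t hK) in ht as [ht et].
    destruct (Sigma_comp hs ht) as (u & hu & hc); exists u; split; [|exact hc].
    apply (in_stab u hK); split; [exact hu|].
    rewrite (@image_comp M hM u s t); auto using Sigma_perm; congruence.
  - intros s hs; apply (in_stab s hK) in hs as [hs es].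
    destruct (Sigma_inverse hs) as (t & ht & hi); exists t; split; [|exact hi].
    apply (in_stab t hK); split; [exact ht|].
    rewrite <- es at 1; apply image_inverse; auto using Sigma_perm.
Qed.

Lemma fixer_inverse C s : base C -> fixer C s ->
  exists t, fixer C t /\ is_inverse t s.
Proof.
  intros [_ hC] [hs hsC]; destruct (Sigma_inverse hs) as (t & ht & hi).
  exists t; split; [split; [exact ht|]|exact hi].
  intros K hK; destruct (hC K hK) as (i & x & _ & hx).
  apply (in_stab t hx); split; [exact ht|].
  assert (es : image s x = x) by (apply (in_stab s hx); auto).
  rewrite <- es at 1; apply image_inverse; auto using Sigma_perm.
Qed.

Definition supports C x : Prop := forall s, fixer C s -> image s x = x.

Lemma symmetricE x : is_symmetric Sigma F x <-> exists C, base C /\ supports C x.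
Proof.
  split.
  - intros (K & hK & hKF); apply (proj2 hF) in hKF as (_ & C & fC & hC & h).
    exists C; split; [now split|]; intros s [hs hsC].
    now apply (in_stab s hK), h.
  - intros (C & [fC hC] & h); destruct (stab_exists x) as (K & hK).
    exists K; split; [exact hK|]; apply (proj2 hF).
    split; [exact (stab_subgroup hK)|]; exists C; split; [exact fC|split; [exact hC|]].
    intros s hs hsC; apply (in_stab s hK); split; [exact hs|]; now apply h.
Qed.

(** Inclusion suffices because the permutations in question form a group. *)
Lemma supports_of_closed C x : base C -> is_set x ->
  (forall s z, fixer C s -> z ∈ x -> image s z ∈ x) -> supports C x.
Proof.
  intros hC hx h s hs; pose proof (Sigma_perm (proj1 hs)) as ps.
  apply set_ext; [now apply image_set | exact hx|]; intros z; split.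
  - intros hz; apply in_image in hz as (y & hy & ->); auto.
  - intros hz; destruct (fixer_inverse hC hs) as (t & ht & hi).
    pose proof (Sigma_perm (proj1 ht)) as pt.
    apply (mem_image (s := t)); [exact pt|].
    rewrite (image_inverse x ps pt hi); auto.
Qed.

Lemma base_void : base void.
Proof. split; [apply finite_void|]; intros K hK; now apply in_void in hK. Qed.

Lemma fixer_void s : fixer void s <-> s ∈ Sigma.
Proof.
  split; [now intros [h _]|]; intros h; split; [exact h|]; intros K hK.
  now apply in_void in hK.
Qed.

Lemma base_cup C C' : base C -> base C' -> base (cup C C').
Proof.
  intros [f h] [f' h']; split; [now apply finite_cup|].
  intros K hK; apply in_cup in hK as [hK|hK]; auto.
Qed.

Lemma fixer_cup C C' s : fixer (cup C C') s <-> fixer C s /\ fixer C' s.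
Proof.
  split.
  - intros [hs h]; split; (split; [exact hs|]); intros K hK; apply h, in_cup; auto.
  - intros [[hs h] [_ h']]; split; [exact hs|]; intros K hK.
    apply in_cup in hK as [hK|hK]; auto.
Qed.

Lemma atom_symmetric x : atom x -> is_symmetric Sigma F x.
Proof.
  intros hx; destruct (enum_onto hx) as (i & hi), (stab_exists x) as (K & hK).
  apply symmetricE; exists (adjoin void K); split; [split|].
  - apply finite_adjoin, finite_void.
  - intros K' h; apply in_adjoin in h as [h| ->]; [now apply in_void in h|].
    now exists i, x.
  - intros s [hs h]; apply (in_stab s hK), h, in_adjoin; auto.
Qed.

(** Distinct atoms of a pair have the same stabilizer, so that a base does not
    determine the atoms behind it; an upper bound of indices that serve is found
    by induction on the base. *)
Lemma base_bounded C : base C -> exists k, k ∈ omega /\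
  forall s, s ∈ Sigma -> (forall i x, i ∈ k -> app a i x -> image s x = x) ->
  fixer C s.
Proof.
  intros [fC hC].
  assert (h : exists k, k ∈ omega /\
    forall s, s ∈ Sigma -> (forall i x, i ∈ k -> app a i x -> act s x x) ->
    forall K, K ∈ C -> s ∈ K).
  { revert C fC hC; apply (@finite_ind M hM (fun C =>
      (forall K, K ∈ C -> exists i x, app a i x /\ is_stab Sigma x K) ->
      exists k, k ∈ omega /\
        forall s, s ∈ Sigma -> (forall i x, i ∈ k -> app a i x -> act s x x) ->
        forall K, K ∈ C -> s ∈ K)).
    - definability.
    - intros _; exists void; split; [apply omega0|]; intros s _ _ K hK.
      now apply in_void in hK.
    - intros C K ih hC; destruct ih as (k & hk & hb).
      { intros K' hK'; apply hC, in_adjoin; auto. }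
      destruct (hC K) as (i & x & hi & hx); [apply in_adjoin; auto|].
      (* the bound must contain the index [i] of the new atom *)
      destruct (nat_directed hk (omegaS (proj1 (enum_val hi)))) as (m & hm & hkm & him).
      exists m; split; [exact hm|]; intros s hs hfix K' hK'.
      apply in_adjoin in hK' as [hK'| ->].
      + apply (hb s hs); [|exact hK']; intros j z hj hz.
        exact (hfix j z (hkm j hj) hz).
      + apply (proj2 hx); split; [exact hs|]; apply (hfix i); [|exact hi].
        apply him, in_succ; auto. }
  destruct h as (k & hk & h); exists k; split; [exact hk|].
  intros s hs hfix; split; [exact hs|]; apply (h s hs); intros i x hi hx.
  apply (actE x x (Sigma_perm hs)); symmetry; eauto.
Qed.

(** * Transpositions *)

Lemma transposition_exists x y : atom x -> atom y ->
  exists s, perm s /\ image s x = y /\ image s y = x /\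
    forall z, atom z -> z <> x -> z <> y -> image s z = z.
Proof.
  intros hx hy.
  set (R u v := (u = x /\ v = y) \/ (u = y /\ v = x) \/ (u <> x /\ u <> y /\ v = u)).
  assert (defR : definable (fun e : nat -> M => R (e 0) (e 1)))
    by (unfold R; definability).
  assert (funR : forall u v v', R u v -> R u v' -> v = v')
    by (unfold R; intros u v v' h h'; intuition congruence).
  assert (symR : forall u v, R u v -> R v u) by (unfold R; intuition congruence).
  assert (totR : forall u, atom u -> exists v, atom v /\ R u v).
  { intros u hu; unfold R; destruct (classic (u = x)) as [e|e]; [exists y; auto|].
    destruct (classic (u = y)) as [e'|e']; [exists x; auto | exists u; auto 6]. }
  destruct (@graph_exists M hM R atoms defR) as (s & hs & hp & _).
  { intros u v v' _; apply funR. }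
  destruct (perm_of_graph hs hp) as [ps happ].
  - intros u v v' _; apply funR.
  - intros u u' v _ _ h h'; apply symR in h, h'; exact (funR _ _ _ h h').
  - exact totR.
  - intros v hv; destruct (totR v hv) as (u & hu & h); exists u; auto.
  - assert (hv : forall u v, atom u -> R u v -> image s u = v)
      by (intros u v hu h; apply image_app; [exact ps | now apply happ]).
    exists s; split; [exact ps|]; repeat split; try intros; apply hv; auto;
      unfold R; auto.
Qed.

(** Beyond any bound there is a pair of atoms, and exchanging its members
    preserves all the pairs because distinct pairs are disjoint. *)
Lemma transposition_in_fixer C : base C ->
  exists s x, fixer C s /\ atom x /\ image s x <> x.
Proof.
  intros hC; destruct (base_bounded hC) as (n & hn & hb).
  destruct (doubling_exists (M := M)) as (d & hd).
  destruct (doubling_total hd hn) as (k & hk).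
  destruct (doubling_val hd hk) as [_ hko].
  destruct (enum_total hko) as (x & hx), (enum_total (omegaS hko)) as (y & hy).
  destruct (transposition_exists (proj2 (enum_val hx)) (proj2 (enum_val hy)))
    as (s & ps & sx & sy & sz).
  assert (kk : k <> succ k).
  { intros e; apply (@mem_irrefl M hM k); rewrite e at 2; apply in_succ; auto. }
  assert (fix_other : forall i z, app a i z -> i <> k -> i <> succ k -> image s z = z).
  { intros i z hi h h'; apply sz; [apply (enum_val hi)| |]; intros ->;
      [apply h | apply h']; eapply enum_inj; eauto. }
  assert (hs : s ∈ Sigma).
  { apply in_Sigma; split; [exact ps|]; intros p hp.
    apply (is_atom_pairE _ hd) in hp as (m & j & u & v & hj & hu & hv & ->).
    rewrite image_pair by exact ps.
    destruct (trichotomy (proj1 (doubling_val hd hj)) hn) as [hmn|[->|hmn]].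
    - pose proof (doubling_mono hd hj hk hmn) as h.
      assert (h' : j ∈ k) by (apply (nat_transitive hko h), in_succ; auto).
      rewrite (fix_other _ _ hu), (fix_other _ _ hv); auto; intros e.
      + subst; now apply mem_irrefl in h.
      + apply succ_inj in e; subst; now apply mem_irrefl in h'.
      + subst; now apply mem_irrefl in h'.
      + subst; apply (mem_asym h'); apply in_succ; auto.
    - rewrite <- (doubling_uniq hd hk hj) in *.
      rewrite <- (enum_uniq hx hu), <- (enum_uniq hy hv), sx, sy; apply pairC.
    - pose proof (doubling_mono hd hk hj hmn) as h.
      destruct (doubling_val hd hj) as [_ hjo].
      assert (h' : k ∈ j) by (apply (nat_transitive hjo h), in_succ; auto).
      rewrite (fix_other _ _ hu), (fix_other _ _ hv); auto; intros e.
      + subst; apply (mem_asym h'); apply in_succ; auto.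
      + apply succ_inj in e; subst; now apply mem_irrefl in h'.
      + subst; now apply mem_irrefl in h'.
      + subst; now apply mem_irrefl in h. }
  exists s, x; split; [|split; [apply (enum_val hx)|]].
  - apply (hb s hs); intros i z hi hz; pose proof (doubling_ge hd hk hi) as hik.
    apply (fix_other i z hz); intros ->.
    + now apply mem_irrefl in hik.
    + apply (mem_asym hik), in_succ; auto.
  - rewrite sx; intros ->; apply kk; eapply enum_inj; eauto.
Qed.

End Frankel.

(** * Hereditarily symmetric objects *)

Section Model.
Context {M : structure} {hM : ZFA M}.
Variables a Sigma F : M.
Hypothesis ha : is_bij a omega atoms.
Hypothesis hSigma : is_pair_group omega atoms a Sigma.
Hypothesis hF : is_atom_stab_filter a Sigma F.

Local Notation symmetric := (is_symmetric Sigma F).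
Local Notation hsym := (is_hereditarily_symmetric Sigma F).
Local Notation N := (perm_model Sigma F).
Local Notation val x := (proj1_sig x).

Lemma hsym_mem (x y : M) : hsym x -> y ∈ x -> hsym y.
Proof.
  intros [_ h] hy; split; [apply h|]; [intros t ht hs; now apply hs|].
  intros z hz; apply h; intros t ht hs; apply (hz t ht).
  exact (proj2 ht y (hs y hy)).
Qed.

(** The hereditarily symmetric members of a transitive set around [x] form a
    transitive set, which contains the transitive closure of [x]. *)
Lemma hsym_intro (x : M) : symmetric x -> (forall y, y ∈ x -> hsym y) -> hsym x.
Proof.
  intros hx h; split; [exact hx|]; intros y hy.
  destruct (transitive_superset x) as (t & [_ ht] & hxt).
  destruct (@separation M hM (fun z => hsym z) t) as (b & hb & inb); [definability|].
  assert (hyb : y ∈ b).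
  { apply hy.
    - split; [exact hb|]; intros z hz u hu; apply inb in hz as [hz hs].
      apply inb; split; [exact (ht z hz u hu) | exact (hsym_mem hs hu)].
    - intros z hz; apply inb; split; [exact (ht x hxt z hz) | auto]. }
  now apply inb in hyb as [_ [hs _]].
Qed.

Lemma hsym_atom (x : M) : atom x -> hsym x.
Proof.
  intros hx; apply hsym_intro; [now apply (atom_symmetric ha hSigma hF)|].
  intros y hy; now apply (zfa_atoms hM) in hy.
Qed.

Lemma hsym_pair (x y : M) : hsym x -> hsym y -> hsym (pair x y).
Proof.
  intros hx hy; apply hsym_intro.
  - destruct hx as [hx _], hy as [hy _]; apply (symmetricE hSigma hF) in hx, hy.
    destruct hx as (C & hC & sx), hy as (C' & hC' & sy).
    apply (symmetricE hSigma hF); exists (cup C C'); split; [now apply base_cup|].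
    intros s hs; apply fixer_cup in hs as [h h'].
    rewrite image_pair, sx, sy; auto; exact (Sigma_perm hSigma (proj1 h)).
  - intros z hz; apply in_pair in hz as [-> | ->]; assumption.
Qed.

Lemma hsym_opair (x y : M) : hsym x -> hsym y -> hsym (opair x y).
Proof. intros; repeat apply hsym_pair; assumption. Qed.

Lemma hsym_app (f x y : M) : hsym f -> app f x y -> hsym x /\ hsym y.
Proof.
  intros hf h; apply appE in h; pose proof (hsym_mem hf h) as hp.
  assert (hxy : hsym (pair x y)) by (apply (hsym_mem hp), in_pair; auto).
  split; apply (hsym_mem hxy), in_pair; auto.
Qed.

(** * Absoluteness for the permutation model *)

Lemma val_inj (x y : N) : val x = val y -> x = y.
Proof.
  destruct x as [x hx], y as [y hy]; simpl; intros ->; f_equal.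
  apply proof_irrelevance.
Qed.

Lemma mem_lift (x : N) (y : M) : y ∈ val x -> exists y' : N, val y' = y.
Proof. intros h; now exists (exist _ y (hsym_mem (proj2_sig x) h)). Qed.

Lemma pairN (p x y : N) : is_pair p x y <-> val p = pair (val x) (val y).
Proof.
  rewrite <- is_pairE; split.
  - intros [hp h]; split; [exact hp|]; intros z; split.
    + intros hz; destruct (mem_lift hz) as (z' & <-).
      apply (h z') in hz as [-> | ->]; auto.
    + intros [-> | ->]; [apply (h x) | apply (h y)]; auto.
  - intros [hp h]; split; [exact hp|]; intros z; split.
    + intros hz; apply (h (val z)) in hz as [e|e]; [left|right]; now apply val_inj.
    + intros [-> | ->]; apply h; auto.
Qed.

(** From right to left, the witnesses are in the permutation model because it is
    closed under pairs. *)
Lemma opairN (p x y : N) : is_opair p x y <-> val p = opair (val x) (val y).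
Proof.
  split.
  - intros (u & v & hu & hv & hp); apply pairN in hu, hv, hp.
    now rewrite hp, hu, hv.
  - intros hp.
    exists (exist _ _ (hsym_pair (proj2_sig x) (proj2_sig x))),
      (exist _ _ (hsym_pair (proj2_sig x) (proj2_sig y))).
    rewrite !pairN; auto.
Qed.

Lemma appN (f x y : N) : app f x y <-> app (val f) (val x) (val y).
Proof.
  rewrite appE; split.
  - intros (p & hp & h); apply opairN in hp; rewrite <- hp; exact h.
  - intros h; exists (exist _ _ (hsym_opair (proj2_sig x) (proj2_sig y))).
    rewrite opairN; auto.
Qed.

Lemma app2N (m x y z : N) :
  app2 m x y z <-> app (val m) (opair (val x) (val y)) (val z).
Proof.
  split.
  - intros (p & hp & h); apply opairN in hp; apply appN in h; now rewrite <- hp.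
  - intros h; exists (exist _ _ (hsym_opair (proj2_sig x) (proj2_sig y))).
    rewrite opairN, appN; auto.
Qed.

Lemma app_lift (f : N) (x y : M) : app (val f) x y ->
  exists x' y' : N, val x' = x /\ val y' = y /\ app f x' y'.
Proof.
  intros h; destruct (hsym_app (proj2_sig f) h) as [hx hy].
  exists (exist _ x hx), (exist _ y hy); rewrite appN; auto.
Qed.

Lemma relN (f x y : N) : is_rel f x y <-> is_rel (val f) (val x) (val y).
Proof.
  split; intros [hf h]; (split; [exact hf|]); intros p hp.
  - destruct (mem_lift hp) as (p' & <-).
    destruct (h p' hp) as (u & v & hu & hv & e).
    apply opairN in e; exists (val u), (val v); rewrite is_opairE; auto.
  - destruct (h (val p) hp) as (u & v & hu & hv & e); apply is_opairE in e.
    destruct (mem_lift hu) as (u' & <-), (mem_lift hv) as (v' & <-).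
    exists u', v'; rewrite opairN; auto.
Qed.

Lemma funN (f x y : N) : is_fun f x y <-> is_fun (val f) (val x) (val y).
Proof.
  unfold is_fun at 1 2; rewrite relN; split; intros [hr h]; (split; [exact hr|]);
    intros u hu.
  - destruct (mem_lift hu) as (u' & <-), (h u' hu) as (v & hv & huniq).
    exists (val v); split; [now apply appN|]; intros v' hv'.
    destruct (app_lift hv') as (u1 & v1 & e & <- & h1); apply val_inj in e; subst.
    f_equal; auto.
  - destruct (h (val u) hu) as (v & hv & huniq).
    destruct (app_lift hv) as (u' & v' & e & <- & h1); apply val_inj in e; subst.
    exists v'; split; [exact h1|]; intros v1 hv1; apply val_inj, huniq; now apply appN.
Qed.

Lemma bijN (f x y : N) : is_bij f x y <-> is_bij (val f) (val x) (val y).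
Proof.
  unfold is_bij at 1 2; rewrite funN.
  split; intros (hf & hi & hs); (split; [exact hf|split]).
  - intros u u' v h h'.
    destruct (app_lift h) as (u1 & v1 & <- & <- & h1).
    destruct (app_lift h') as (u2 & v2 & <- & e & h2); apply val_inj in e; subst.
    f_equal; eauto.
  - intros v hv; destruct (mem_lift hv) as (v' & <-), (hs v' hv) as (u & hu).
    exists (val u); now apply appN.
  - intros u u' v h h'; apply val_inj; apply appN in h, h'; eauto.
  - intros v hv; destruct (hs (val v) hv) as (u & hu).
    destruct (app_lift hu) as (u' & v' & <- & e & h); apply val_inj in e; subst.
    now exists u'.
Qed.

Lemma compN (u s t : N) : is_comp u s t -> is_comp (val u) (val s) (val t).
Proof.
  intros h x y z hxy hyz.
  destruct (app_lift hxy) as (x' & y' & <- & <- & h1).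
  destruct (app_lift hyz) as (y1 & z' & e & <- & h2); apply val_inj in e; subst.
  apply appN; eauto.
Qed.

End Model.

(** * Symmetric difference *)

Section SymmetricDifference.
Context {M : structure} {hM : ZFA M}.
Implicit Types (x y z u v s : M).

Definition is_sdiff z x y : Prop :=
  is_set z /\ forall u, u ∈ z <-> (u ∈ x /\ ~ u ∈ y) \/ (~ u ∈ x /\ u ∈ y).

Lemma sdiff_exists x y : exists z, is_sdiff z x y.
Proof.
  destruct (@separation M hM (fun u => (u ∈ x /\ ~ u ∈ y) \/ (~ u ∈ x /\ u ∈ y)) (cup x y))
    as (z & hz & h); [definability|].
  exists z; split; [exact hz|]; intros u; rewrite h, in_cup; tauto.
Qed.

Definition sdiff x y : M := witness (sdiff_exists x y).

Lemma sdiff_set x y : is_set (sdiff x y).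
Proof. apply (witnessP (sdiff_exists x y)). Qed.

Lemma in_sdiff x y u : u ∈ sdiff x y <-> (u ∈ x /\ ~ u ∈ y) \/ (~ u ∈ x /\ u ∈ y).
Proof. apply (witnessP (sdiff_exists x y)). Qed.

Lemma is_sdiffE z x y : is_sdiff z x y <-> z = sdiff x y.
Proof.
  split; [|intros ->; apply (witnessP (sdiff_exists x y))].
  intros [hz h]; apply set_ext; [exact hz | apply sdiff_set|].
  intros u; now rewrite h, in_sdiff.
Qed.

Lemma sdiffC x y : sdiff x y = sdiff y x.
Proof.
  apply set_ext; try apply sdiff_set; intros u; rewrite !in_sdiff; tauto.
Qed.

Lemma sdiffA x y z : sdiff x (sdiff y z) = sdiff (sdiff x y) z.
Proof.
  apply set_ext; try apply sdiff_set; intros u; rewrite !in_sdiff.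
  destruct (classic (u ∈ x)), (classic (u ∈ y)), (classic (u ∈ z)); tauto.
Qed.

Lemma sdiff_voidr x : is_set x -> sdiff x void = x.
Proof.
  intros hx; apply set_ext; [apply sdiff_set | exact hx|]; intros u.
  rewrite in_sdiff; pose proof (@in_void M hM u); tauto.
Qed.

Lemma sdiff_diag x : sdiff x x = void.
Proof.
  apply set_ext; [apply sdiff_set | apply void_set|]; intros u.
  rewrite in_sdiff; pose proof (@in_void M hM u); tauto.
Qed.

Lemma image_sdiff s x y : perm s ->
  image s (sdiff x y) = sdiff (image s x) (image s y).
Proof.
  intros hs; apply set_ext; [apply image_set, sdiff_set; exact hs | apply sdiff_set|].
  intros u; rewrite in_sdiff; split.
  - intros hu; apply in_image in hu as (z & hz & ->); [|exact hs].
    rewrite !mem_image by exact hs; now apply in_sdiff.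
  - intros h; assert (hu : exists z, u = image s z).
    { destruct h as [[h _]|[_ h]]; apply in_image in h as (z & _ & ->); eauto. }
    destruct hu as (z & ->); rewrite !mem_image in h by exact hs.
    now apply mem_image, in_sdiff.
Qed.

Lemma product_exists x y : exists p, is_set p /\
  forall q, q ∈ p <-> exists u v, u ∈ x /\ v ∈ y /\ q = opair u v.
Proof.
  destruct (power_exists (cup x y)) as (b & hb & inb), (power_exists b) as (c & hc & inc).
  destruct (@separation M hM (fun q => exists u v, u ∈ x /\ v ∈ y /\ q = opair u v) c)
    as (p & hp & inp); [definability|].
  exists p; split; [exact hp|]; intros q; rewrite inp; split; [tauto|].
  intros (u & v & hu & hv & ->); split; [|eauto 6].
  assert (h : forall w, w = u \/ w = v -> pair u w ∈ b).
  { intros w hw; apply inb; split; [apply pair_set|]; intros z hz.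
    apply in_cup; apply in_pair in hz as [-> | ->]; auto.
    destruct hw as [-> | ->]; auto. }
  apply inc; split; [apply pair_set|]; intros z hz.
  apply in_pair in hz as [-> | ->]; auto.
Qed.

End SymmetricDifference.

(** * The group of the symmetric sets of atoms *)

Section Counterexample.
Context {M : structure} {hM : ZFA M}.
Variables a Sigma F : M.
Hypothesis ha : is_bij a omega atoms.
Hypothesis hSigma : is_pair_group omega atoms a Sigma.
Hypothesis hF : is_atom_stab_filter a Sigma F.

Local Notation symmetric := (is_symmetric Sigma F).
Local Notation hsym := (is_hereditarily_symmetric Sigma F).
Local Notation N := (perm_model Sigma F).
Local Notation val x := (proj1_sig x).

Definition sym_atoms (x : M) : Prop := is_set x /\ subset x atoms /\ symmetric x.

Lemma sym_atoms_set_exists :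
  exists G : M, is_set G /\ forall x, x ∈ G <-> sym_atoms x.
Proof.
  destruct (power_exists atoms) as (b & hb & inb).
  destruct (@separation M hM (fun x => symmetric x) b) as (G & hG & inG); [definability|].
  exists G; split; [exact hG|]; intros x; rewrite inG, inb; unfold sym_atoms; tauto.
Qed.

Lemma sym_atoms_void : sym_atoms void.
Proof.
  split; [apply void_set|split].
  - intros u hu; now apply in_void in hu.
  - apply (symmetricE hSigma hF); exists void; split; [apply base_void|].
    apply (supports_of_closed hSigma); [apply base_void | apply void_set|].
    intros s z _ hz; now apply in_void in hz.
Qed.

Lemma sym_atoms_singleton x : atom x -> sym_atoms (pair x x).
Proof.
  intros hx; split; [apply pair_set|split].
  - intros u hu; apply in_pair in hu; apply in_atoms; destruct hu; now subst.
  - apply (hsym_pair hSigma hF); apply (hsym_atom ha hSigma hF hx).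
Qed.

Lemma sym_atoms_sdiff x y : sym_atoms x -> sym_atoms y -> sym_atoms (sdiff x y).
Proof.
  intros (_ & sx & hx) (_ & sy & hy); split; [apply sdiff_set|split].
  - intros u hu; apply in_sdiff in hu as [[h _]|[_ h]]; auto.
  - apply (symmetricE hSigma hF) in hx as (C & hC & h), hy as (C' & hC' & h').
    apply (symmetricE hSigma hF); exists (cup C C'); split; [now apply base_cup|].
    intros s hs; apply fixer_cup in hs as [k k'].
    rewrite image_sdiff, h, h'; auto; exact (Sigma_perm hSigma (proj1 k)).
Qed.

(** Supports are preserved because the group is commutative. *)
Lemma sym_atoms_image s x : s ∈ Sigma -> sym_atoms x -> sym_atoms (image s x).
Proof.
  intros hs (sx & hx & hsym); pose proof (Sigma_perm hSigma hs) as ps.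
  split; [now apply image_set|split].
  - intros u hu; apply in_image in hu as (z & hz & ->); [|exact ps].
    apply in_atoms, atom_image; [exact ps|]; now apply in_atoms, hx.
  - apply (symmetricE hSigma hF) in hsym as (C & hC & h).
    apply (symmetricE hSigma hF); exists C; split; [exact hC|]; intros t ht.
    rewrite (Sigma_commute ha hSigma x (proj1 ht) hs); f_equal; now apply h.
Qed.

Lemma hsym_of_invariant (x : M) : is_set x ->
  (forall s z, s ∈ Sigma -> z ∈ x -> image s z ∈ x) ->
  (forall z, z ∈ x -> hsym z) -> hsym x.
Proof.
  intros hx h hel; apply hsym_intro; [|exact hel].
  apply (symmetricE hSigma hF); exists void; split; [apply base_void|].
  apply (supports_of_closed hSigma (base_void a Sigma) hx).
  intros s z hs; apply fixer_void in hs; auto.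
Qed.

Lemma hsym_sym_atoms x : sym_atoms x -> hsym x.
Proof.
  intros (_ & hx & hs); apply hsym_intro; [exact hs|]; intros y hy.
  apply (hsym_atom ha hSigma hF); now apply in_atoms, hx.
Qed.

Lemma sym_atoms_group : exists G m : N,
  is_group G m /\ (forall x, x ∈ val G <-> sym_atoms x) /\
  (forall x y, sym_atoms x -> sym_atoms y -> app (val m) (opair x y) (sdiff x y)).
Proof.
  destruct sym_atoms_set_exists as (G & hG & inG).
  destruct (product_exists G G) as (p & hp & inp).
  set (R q z := exists x y, q = opair x y /\ is_sdiff z x y).
  assert (defR : definable (fun e : nat -> M => R (e 0) (e 1)))
    by (unfold R; definability).
  assert (RE : forall x y z, R (opair x y) z <-> z = sdiff x y).
  { intros x y z; unfold R; split.
    - intros (x' & y' & e & h); apply opair_inj in e as [-> ->]; now apply is_sdiffE.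
    - intros ->; exists x, y; rewrite is_sdiffE; auto. }
  assert (funR : forall q z z', q ∈ p -> R q z -> R q z' -> z = z').
  { intros q z z' hq; apply inp in hq as (x & y & _ & _ & ->).
    rewrite !RE; congruence. }
  destruct (graph_exists defR funR) as (m & hm & hmp & happ).
  assert (appm : forall x y z, app m (opair x y) z <->
            sym_atoms x /\ sym_atoms y /\ z = sdiff x y).
  { intros x y z; rewrite happ, RE, inp, <- !inG; split.
    - intros [(u & v & hu & hv & e) ->]; apply opair_inj in e as [-> ->]; auto.
    - intros (hx & hy & ->); eauto 7. }
  assert (hsG : hsym G).
  { apply hsym_of_invariant; [exact hG| |].
    - intros s z hs hz; apply inG in hz; now apply inG, sym_atoms_image.
    - intros z hz; now apply hsym_sym_atoms, inG. }
  assert (hsp : hsym p).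
  { apply hsym_of_invariant; [exact hp| |].
    - intros s z hs hz; apply inp in hz as (x & y & hx & hy & ->).
      rewrite image_opair by exact (Sigma_perm hSigma hs); apply inp.
      exists (image s x), (image s y); rewrite !inG in *; auto using sym_atoms_image.
    - intros z hz; apply inp in hz as (x & y & hx & hy & ->).
      apply (hsym_opair hSigma hF); now apply hsym_sym_atoms, inG. }
  assert (hsm : hsym m).
  { apply hsym_of_invariant; [exact hm| |].
    - intros s q hs hq; apply hmp in hq as (o & z & ho & hz & ->).
      apply inp in ho as (x & y & hx & hy & ->); apply RE in hz as ->.
      pose proof (Sigma_perm hSigma hs) as ps; apply inG in hx, hy.
      rewrite !image_opair, image_sdiff by exact ps; apply appE, appm.
      auto using sym_atoms_image.
    - intros q hq; apply hmp in hq as (o & z & ho & hz & ->).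
      apply (hsym_opair hSigma hF); [exact (hsym_mem hsp ho)|].
      apply inp in ho as (x & y & hx & hy & ->); apply RE in hz as ->.
      apply inG in hx, hy; now apply hsym_sym_atoms, sym_atoms_sdiff. }
  set (GN := exist _ G hsG : N); set (mN := exist _ m hsm : N).
  assert (app2m : forall x y z : N, app2 mN x y z <->
     sym_atoms (val x) /\ sym_atoms (val y) /\ val z = sdiff (val x) (val y)).
  { intros x y z; rewrite (app2N hSigma hF); apply appm. }
  exists GN, mN; split; [|split].
  - split; [exact hG|split; [|split]].
    + exists (exist _ p hsp); split.
      * split; [exact hp|]; intros q; split.
        -- intros hq; apply inp in hq as (x & y & hx & hy & e).
           destruct (mem_lift (x := GN) hx) as (x' & <-).
           destruct (mem_lift (x := GN) hy) as (y' & <-).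
           exists x', y'; rewrite (opairN hSigma hF); auto.
        -- intros (x & y & hx & hy & e); apply (opairN hSigma hF) in e.
           apply inp; exists (val x), (val y); auto.
      * apply (funN hSigma hF); apply (graph_is_fun hm hmp funR).
        intros q hq; apply inp in hq as (x & y & hx & hy & ->).
        exists (sdiff x y); rewrite RE; split; [|reflexivity].
        apply inG in hx, hy; now apply inG, sym_atoms_sdiff.
    + intros x y z xy yz r _ _ _ h1 h2 h3; apply app2m in h1, h2, h3.
      destruct h1 as (h1 & h1' & e1), h2 as (h2 & h2' & e2), h3 as (h3 & h3' & e3).
      apply app2m; split; [exact h1|split].
      * rewrite e2; now apply sym_atoms_sdiff.
      * now rewrite e3, e1, e2, sdiffA.
    + exists (exist _ _ (hsym_sym_atoms sym_atoms_void)).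
      split; [apply inG, sym_atoms_void|split].
      * intros x hx; apply inG in hx; rewrite !app2m; simpl.
        assert (e : sdiff (val x) void = val x) by (apply sdiff_voidr, hx).
        rewrite (sdiffC void), e; auto 7 using sym_atoms_void.
      * intros x hx; exists x; split; [exact hx|]; apply inG in hx.
        rewrite !app2m; simpl; rewrite sdiff_diag; auto.
  - exact inG.
  - intros x y hx hy; apply appm; auto.
Qed.

(** * Automorphism groups of graphs *)

(** A permutation [t] fixing [V] maps the pair of [u] and [s[u]] to the pair of
    [t[u]] and [s[t[u]]], since [s] and [t] commute.  So whatever supports [V]
    supports the restriction. *)
Lemma hsym_restriction (V s : M) : hsym V -> s ∈ Sigma ->
  (forall v, v ∈ V -> image s v ∈ V) ->
  exists r : N, is_set (val r) /\
    (forall p, p ∈ val r <-> exists u v, u ∈ V /\ v = image s u /\ p = opair u v) /\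
    (forall u v, app (val r) u v <-> u ∈ V /\ v = image s u).
Proof.
  intros hV hs hclosed; pose proof (Sigma_perm hSigma hs) as ps.
  destruct (@graph_exists M hM (fun u v => v = image s u) V) as (r & hr & hp & happ).
  - definability.
  - congruence.
  - assert (h : hsym r).
    { apply hsym_intro.
      - destruct hV as [hV _]; apply (symmetricE hSigma hF) in hV as (C & hC & sV).
        apply (symmetricE hSigma hF); exists C; split; [exact hC|].
        apply (supports_of_closed hSigma hC hr); intros t p ht h.
        apply hp in h as (u & v & hu & -> & ->).
        pose proof (Sigma_perm hSigma (proj1 ht)) as pt.
        rewrite image_opair by exact pt; apply hp.
        exists (image t u), (image t (image s u)); repeat split.
        + rewrite <- (sV t ht); now apply mem_image.
        + exact (Sigma_commute ha hSigma u (proj1 ht) hs).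
      - intros p h; apply hp in h as (u & v & hu & -> & ->).
        apply (hsym_opair hSigma hF); apply (hsym_mem hV); auto. }
    exists (exist _ r h); auto.
Qed.

Lemma restriction_bij (V s : M) (r : M) : perm s -> image s V = V -> is_set r ->
  (forall p, p ∈ r <-> exists u v, u ∈ V /\ v = image s u /\ p = opair u v) ->
  is_bij r V V.
Proof.
  intros ps eV hr hp.
  assert (happ : forall u v, app r u v <-> u ∈ V /\ v = image s u).
  { intros u v; rewrite appE, hp; split; [|intros [hu hv]; eauto 6].
    intros (u' & v' & hu & -> & e); apply opair_inj in e as [-> ->]; auto. }
  split; [|split].
  - apply (graph_is_fun hr hp); [congruence|]; intros u hu.
    exists (image s u); split; [|reflexivity]; rewrite <- eV; now apply mem_image.
  - intros u u' v h h'; apply happ in h as [_ ->], h' as [_ e].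
    exact (image_inj ps e).
  - intros v hv; rewrite <- eV in hv; apply in_image in hv as (u & hu & ->); auto.
    exists u; now apply happ.
Qed.

(** The image of a function under [s] is its conjugate by the restriction of
    [s]. *)
Lemma image_fixed_of_commute (V s f : M) : perm s -> image s V = V ->
  is_bij f V V ->
  (forall u v, app f u v -> app f (image s u) (image s v)) -> image s f = f.
Proof.
  intros ps eV [hf _] hc; pose proof (proj1 hf) as [hset hr].
  apply set_ext; [now apply image_set | exact hset|]; intros z; split.
  - intros hz; apply in_image in hz as (p & hp & ->); [|exact ps].
    destruct (hr p hp) as (u & v & _ & _ & e); apply is_opairE in e; subst p.
    rewrite image_opair by exact ps; apply appE, hc; now apply appE.
  - intros hz; destruct (hr z hz) as (u & v & hu & hv & e); apply is_opairE in e; subst z.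
    rewrite <- eV in hu; apply in_image in hu as (u' & hu' & ->); [|exact ps].
    destruct (fun_total hf hu') as (v' & hv').
    assert (e : v = image s v').
    { apply (fun_uniq hf (u := image s u')); [now apply appE | now apply hc]. }
    rewrite e, <- image_opair by exact ps; apply mem_image; [exact ps|]; now apply appE.
Qed.

Theorem frucht_fails : ~ Frucht N.
Proof.
  intros hFr; destruct sym_atoms_group as (G & m & hgrp & inG & appm).
  destruct (hFr G m hgrp) as (V & E & P & c & f & hgraph & haut & hbij & hmul).
  destruct haut as (hP & inP & hbin & hcomp).
  assert (hsupp : forall x : N, exists C, base a Sigma C /\ supports Sigma C (val x)).
  { intros x; apply (symmetricE hSigma hF), (proj1 (proj2_sig x)). }
  destruct (hsupp V) as (C1 & b1 & s1), (hsupp E) as (C2 & b2 & s2),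
    (hsupp f) as (C3 & b3 & s3).
  (* [s] fixes [V], [E] and [f], but not the atom [x] *)
  destruct (transposition_in_fixer ha hSigma (base_cup b1 (base_cup b2 b3)))
    as (s & x & hs & hx & hsx).
  apply fixer_cup in hs as [h1 hs]; apply fixer_cup in hs as [h2 h3].
  pose proof (proj1 h1) as hsS; pose proof (Sigma_perm hSigma hsS) as ps.
  pose proof (s1 s h1) as eV; pose proof (s2 s h2) as eE; pose proof (s3 s h3) as ef.
  assert (hclosed : forall v, v ∈ val V -> image s v ∈ val V).
  { intros v hv; rewrite <- eV; now apply mem_image. }
  destruct (hsym_restriction (proj2_sig V) hsS hclosed) as (r & hr & hrp & happr).
  assert (hrP : r ∈ P).
  { apply inP; split.
    - apply (bijN hSigma hF); exact (restriction_bij ps eV hr hrp).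
    - intros u v u' v' hu hv; apply (appN hSigma hF) in hu, hv.
      apply happr in hu as [_ eu], hv as [_ ev].
      rewrite !(appN hSigma hF), eu, ev.
      rewrite <- (app_image (val E) (val u) (val v) ps), eE; reflexivity. }
  apply (bijN hSigma hF) in hbij as hbijM.
  assert (autM : forall q : N, q ∈ P -> is_bij (val q) (val V) (val V)).
  { intros q hq; apply inP in hq as [hq _]; now apply (bijN hSigma hF) in hq. }
  assert (valf : forall g : N, g ∈ G -> exists q : N, app f g q /\ q ∈ P).
  { intros g hg; destruct (fun_total (proj1 hbijM) hg) as (q & hq).
    destruct (app_lift hSigma hF hq) as (g' & q' & e & <- & h).
    apply val_inj in e; subst g'; exists q'; split; [exact h|].
    apply (fun_dom (proj1 hbijM) hq). }
  (* [g] is the singleton of [x], and [k] the group element that [f] maps to the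
     restriction [r] of [s]; they commute, so that [r] commutes with [alpha] *)
  assert (hxG : pair x x ∈ val G) by now apply inG, sym_atoms_singleton.
  destruct (mem_lift hxG) as (g & eg); rewrite <- eg in hxG.
  destruct (valf g hxG) as (alpha & fg & halpha).
  destruct (proj2 (proj2 hbij) r hrP) as (k & fk).
  assert (hkG : val k ∈ val G).
  { apply (appN hSigma hF) in fk; apply (fun_dom (proj1 hbijM) fk). }
  apply inG in hkG as sk; apply inG in hxG as sg.
  assert (hkgG : sdiff (val k) (val g) ∈ val G) by now apply inG, sym_atoms_sdiff.
  destruct (mem_lift hkgG) as (h & eh); rewrite <- eh in hkgG.
  destruct (valf h hkgG) as (beta & fh & hbeta).
  assert (comp1 : is_comp (val beta) (val r) (val alpha)).
  { apply (compN hSigma hF), hcomp, (hmul _ _ _ _ _ _ fk fg fh).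
    apply (app2N hSigma hF); rewrite eh; auto. }
  assert (comp2 : is_comp (val beta) (val alpha) (val r)).
  { apply (compN hSigma hF), hcomp, (hmul _ _ _ _ _ _ fg fk fh).
    apply (app2N hSigma hF); rewrite eh, sdiffC; auto. }
  assert (ealpha : image s (val alpha) = val alpha).
  { apply (image_fixed_of_commute ps eV (autM alpha halpha)); intros u v huv.
    pose proof (proj1 (autM alpha halpha)) as fa.
    destruct (fun_dom fa huv) as [hu hv].
    destruct (fun_total fa (hclosed u hu)) as (w & hw).
    replace (image s v) with w; [exact hw|].
    apply (fun_uniq (proj1 (autM beta hbeta)) (u := u)).
    - apply (comp2 u (image s u)); [now apply happr | exact hw].
    - apply (comp1 u v); [exact huv | now apply happr]. }
  (* both [g] and its image under [s] are mapped by [f] to [alpha] *)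
  apply (appN hSigma hF) in fg as fgM; pose proof fgM as fgM'.
  apply (app_image _ _ _ ps) in fgM'; rewrite ef, ealpha in fgM'.
  pose proof (proj1 (proj2 hbijM) _ _ _ fgM' fgM) as e.
  rewrite eg, image_pair in e by exact ps.
  now apply pair_diag in e.
Qed.

End Counterexample.

Theorem mainTheorem5 (M : structure) (hM : ZFA M)
  (w A a : M)
  (hw : is_omega w)
  (hA : is_atom_set A)
  (ha : is_bij a w A)
  (Sigma : M) (hSigma : is_pair_group w A a Sigma)
  (F : M) (hF : is_atom_stab_filter a Sigma F) :
  ~ Frucht (perm_model Sigma F).
Proof.
  apply is_omegaE in hw; apply is_atom_setE in hA; subst w A.
  exact (frucht_fails ha hSigma hF).
Qed.
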